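(* Let $T\subset\mathbb{R}^3$ be a (nondegenerate) tetrahedron and $k\in\{2,3\}$. Any function $v\in P_{k+1}(T)$ is uniquely determined by the degrees of freedom $$\int_F v\,q\,ds\quad\text{for all } q\in P_{k-1}(F),\ F\in\mathcal{F}(T),$$ $$\int_T v\,q\,dx\quad\text{for all } q\in\mathfrak{B}_{k+1}(T).$$
   Context: $P_m(S)$ denotes the space of real polynomials of degree at most $m$ on $S$ (for $S$ a tetrahedron or a triangular face). $\mathcal{F}(T)$ is the set of the four faces of $T$. The bubble function space is $$\mathfrak{B}_{k+1}(T)=\Big\{v\in P_{k+1}(T)\ \Big|\ \int_F v\,q\,ds=0\ \text{ for all } q\in P_{k-1}(F),\ F\in\mathcal{F}(T)\Big\}.$$ ''Uniquely determined by the degrees of freedom'' is meant in the usual finite element sense of unisolvence: letting $q$ run through a basis of $P_{k-1}(F)$ for each of the four faces $F$ and through a basis of $\mathfrak{B}_{k+1}(T)$, for every prescribed choice of values of the resulting finite list of functionals there is exactly one $v\in P_{k+1}(T)$ taking these values. *)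

(* Defs.v *)
From HB Require Import structures.
From mathcomp Require Import all_boot all_order all_algebra.
From mathcomp Require Import all_classical all_reals all_analysis.
(* The notations of mpoly clash with those of mathcomp-analysis. *)
From mathcomp Require Import -(notations) mpoly.

Set Implicit Arguments.
Unset Strict Implicit.
Unset Printing Implicit Defensive.

Import Order.TTheory GRing.Theory Num.Theory.

Local Open Scope classical_set_scope.
Local Open Scope ring_scope.

Definition affinely_independent (R : realType) (n : nat)
    (a : 'I_n.+1 -> 'rV[R]_3) : Prop :=
  row_free (\matrix_(i < n) (a (lift ord0 i) - a ord0)).

Definition simplex (R : realType) (n : nat) (a : 'I_n -> 'rV[R]_3) :
    set 'rV[R]_3 :=
  [set x | exists c : 'I_n -> R,
     [/\ forall i, 0 <= c i, \sum_i c i = 1 & x = \sum_i c i *: a i]].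

(* The faces of the tetrahedron [simplex a] are the triangles
   [simplex (face a i)]; face i is the one opposite to the vertex [a i]. *)
Definition face (R : realType) (a : 'I_4 -> 'rV[R]_3) (i : 'I_4) :
    'I_3 -> 'rV[R]_3 :=
  fun j => a (lift i j).

(* P_m(S).  A function on S is represented by its extension by 0 to R^3
   so that equality of representatives is equality of functions on S.
   [msize p] is 1 + the degree of p, and 0 for p = 0. *)
Definition poly_space (R : realType) (m : nat) (S : set 'rV[R]_3) :
    set ('rV[R]_3 -> R) :=
  [set f | exists2 p : mpoly 3 R, (mpoly.msize p <= m.+1)%N &
     f = patch (fun=> 0) S (fun x => meval (fun i => x ord0 i) p)].

Definition coord3 (R : realType) (x : R * R * R) : 'rV[R]_3 :=
  \row_(i < 3) [:: x.1.1; x.1.2; x.2]`_i.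

(* Integral over S with respect to the Lebesgue measure of R^3. *)
Definition volume_integral (R : realType) (S : set 'rV[R]_3)
    (f : 'rV[R]_3 -> R) : R :=
  \int[(lebesgue_measure \x lebesgue_measure \x lebesgue_measure)%E]_(x in
    @coord3 R @^-1` S) f (coord3 x).

Definition reference_triangle (R : realType) : set (R * R) :=
  [set s | [/\ 0 <= s.1, 0 <= s.2 & s.1 + s.2 <= 1]].

(* Surface integral over the triangle with vertices b, through its affine
   parametrization by the reference triangle; the square root of the Gram
   determinant of the two edge vectors is the (constant) surface element. *)
Definition triangle_integral (R : realType) (b : 'I_3 -> 'rV[R]_3)
    (f : 'rV[R]_3 -> R) : R :=
  let E := \matrix_(i < 2) (b (lift ord0 i) - b ord0) in
  Num.sqrt (\det (E *m E^T)) *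
  \int[(lebesgue_measure \x lebesgue_measure)%E]_(s in
    @reference_triangle R)
    f (b ord0 + s.1 *: row 0 E + s.2 *: row 1 E).

(* The index is shifted: [bubble_space k a] is B_{k+1}(T), T = [simplex a]. *)
Definition bubble_space (R : realType) (k : nat) (a : 'I_4 -> 'rV[R]_3) :
    set ('rV[R]_3 -> R) :=
  [set v | poly_space k.+1 (simplex a) v /\
     forall (i : 'I_4) (q : 'rV[R]_3 -> R),
       poly_space k.-1 (simplex (face a i)) q ->
       triangle_integral (face a i) (fun x => v x * q x) = 0].

Definition is_basis (R : realType) (X : Type) (W : set (X -> R)) (n : nat)
    (b : 'I_n -> X -> R) : Prop :=
  (forall j, W (b j)) /\
  (forall w, W w -> exists! c : 'rV[R]_n,
     w = fun x => \sum_(j < n) c ord0 j * b j x).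

(* Main.v *)
Require Import Defs.
From HB Require Import structures.
From mathcomp Require Import all_boot all_order all_algebra.
From mathcomp Require Import all_classical all_reals all_analysis.
From mathcomp Require Import measurable_realfun.
From mathcomp Require Import -(notations) mpoly.
From mathcomp Require Import ring lra zify.

Set Implicit Arguments.
Unset Strict Implicit.
Unset Printing Implicit Defensive.

Import Order.TTheory GRing.Theory Num.Theory.
Import numFieldNormedType.Exports.
Local Open Scope classical_set_scope.
Local Open Scope ring_scope.

(** Both halves of the statement reduce to facts about one triangle and to the
    positivity of the integral of a square.

    Uniqueness: the difference of two solutions has no moments against
    P_(k-1) on any face, so it is a bubble; it is also orthogonal to all
    bubbles, hence to itself, and a polynomial whose square integrates to 0
    over a tetrahedron vanishes there ([volume_integral_sqr_eq0], [dofs_eq0]).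

    Existence: it is enough to prescribe the moments on one face l at a time,
    with zero moments on the three others, and then to correct the volume
    moments by a bubble. A finite family of linear functionals on a space W
    takes arbitrary values on W as soon as no nontrivial combination of them
    vanishes on W ([dual_interpolation]). For bubbles the Gram matrix is
    definite, by the same positivity. For a face l with vertices j, m, n, take
    for W the polynomials of degree at most k+1 without moments on the other
    faces, and suppose that q of degree at most k-1 on l is orthogonal to all of
    W. With lambda the barycentric coordinates of the tetrahedron, W contains

    - lambda_j lambda_m lambda_n times any monomial of degree k-2 in these three
      coordinates, which vanishes on the other faces ([one_face_bubble]);
    - the Radau polynomial of degree k+1 in (lambda_j, lambda_l), homogenized
      ([one_face_edge]). It vanishes on the face opposite to j, it is orthogonal
      to P_(k-1) on the two faces containing the edge from j to l
      ([radau_orthogonal]), and on l, where lambda_l = 0, it is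
      lambda_j ^ (k+1).

    So on the triangle l the polynomial q is orthogonal to the three powers
    lambda_j ^ (k+1) and to lambda_j lambda_m lambda_n P_(k-2). These are 4
    conditions on 3 coefficients for k = 2 and 6 conditions on 6 coefficients
    for k = 3, and Dirichlet's formula for the integrals of barycentric
    monomials ([reference_integral_monomial]) shows that they force q = 0
    ([triangle_form_nondegenerate]). *)

(** * Bounded measurable functions *)

(** The only way properties of polynomial functions enter below: measurability,
    boundedness and continuity all pass from the coordinates to any polynomial
    in them. *)
Lemma meval_closed_ind (R : comNzRingType) (n : nat) (T : Type)
    (h : 'I_n -> T -> R) (P : (T -> R) -> Prop) :
  (forall c, P (fun=> c)) ->
  (forall f g, P f -> P g -> P (fun t => f t + g t)) ->
  (forall f g, P f -> P g -> P (fun t => f t * g t)) ->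
  (forall i, P (h i)) ->
  forall p : mpoly n R, P (fun t => meval (fun i => h i t) p).
Proof.
move=> Pc PD PM Ph.
have PX f k : P f -> P (fun t => f t ^+ k).
  move=> Pf; elim: k => [|k IH]; first exact: Pc.
  under eq_fun do rewrite exprS.
  exact: PM.
have Pprod (r : seq 'I_n) (m : 'I_n -> nat) :
    P (fun t => \prod_(i <- r) h i t ^+ m i).
  elim: r => [|i r IH].
    by under eq_fun do rewrite big_nil; apply: Pc.
  under eq_fun do rewrite big_cons.
  by apply: PM => //; apply: PX.
elim/mpolyind => [|c m p _ _ Pp].
  by under eq_fun do rewrite meval0; apply: Pc.
under eq_fun do rewrite mevalD mevalZ mevalX.
by apply: PD => //; apply: PM.
Qed.

Section BoundedMeasurable.
Context d (T : measurableType d) (R : realType) (mu : {measure set T -> \bar R}).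
Variable D : set T.
Hypothesis mD : measurable D.

(** On a set of finite measure these functions are integrable, and unlike the
    integrable ones they are stable under products. *)
Definition bounded_measurable (f : T -> R) : Prop :=
  measurable_fun D f /\ exists M, forall x, D x -> `|f x| <= M.

Lemma bounded_measurable_cst c : bounded_measurable (fun=> c).
Proof. by split; [exact: measurable_cst | exists `|c|]. Qed.

Lemma bounded_measurableD f g : bounded_measurable f -> bounded_measurable g ->
  bounded_measurable (fun x => f x + g x).
Proof.
move=> [mf [M fM]] [mg [N gN]]; split; first exact: measurable_funD.
exists (M + N) => x Dx; rewrite (le_trans (ler_normD _ _))// lerD //; auto.
Qed.

Lemma bounded_measurableM f g : bounded_measurable f -> bounded_measurable g ->
  bounded_measurable (fun x => f x * g x).
Proof.
move=> [mf [M fM]] [mg [N gN]]; split; first exact: measurable_funM.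
by exists (M * N) => x Dx; rewrite normrM ler_pM //; auto.
Qed.

Lemma bounded_measurable_eq f g : (forall x, D x -> f x = g x) ->
  bounded_measurable f -> bounded_measurable g.
Proof.
move=> fg [mf [M fM]]; split.
  by apply: eq_measurable_fun mf => x /set_mem/fg.
by exists M => x Dx; rewrite -fg //; auto.
Qed.

Lemma bounded_measurable_sum (I : Type) (r : seq I) (F : I -> T -> R) :
  (forall i, bounded_measurable (F i)) ->
  bounded_measurable (fun x => \sum_(i <- r) F i x).
Proof.
move=> HF; elim: r => [|i r IH].
  by under eq_fun do rewrite big_nil; exact: bounded_measurable_cst.
by under eq_fun do rewrite big_cons; exact: bounded_measurableD.
Qed.

Hypothesis D_fin : (mu D < +oo)%E.

Lemma bounded_measurable_integrable f :
  bounded_measurable f -> mu.-integrable D (EFin \o f).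
Proof.
move=> [mf [M fM]]; apply: measurable_bounded_integrable => //.
exists M; split; first exact: num_real.
by move=> N MN x Dx /=; apply: le_trans (fM _ Dx) (ltW MN).
Qed.

Lemma Rintegral_linear f g c : bounded_measurable f -> bounded_measurable g ->
  \int[mu]_(x in D) (c * f x + g x) =
  c * \int[mu]_(x in D) f x + \int[mu]_(x in D) g x.
Proof.
move=> bf bg; rewrite RintegralD //; first last.
- exact: bounded_measurable_integrable.
- apply: bounded_measurable_integrable; apply: bounded_measurableM => //.
  exact: bounded_measurable_cst.
by rewrite RintegralZl //; exact: bounded_measurable_integrable.
Qed.

End BoundedMeasurable.

(** * Integrals of barycentric monomials over the reference triangle *)

(** A primitive of t^b (h - t)^c, built by integrating by parts until the second
    factor disappears; its value at h is the Beta integral scaled to [0, h]. *)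
Lemma poly_beta_primitive (R : realType) (h : R) (b c : nat) :
  exists P : {poly R}, [/\ P^`() = 'X ^+ b * (h%:P - 'X) ^+ c, P.[0] = 0 &
    P.[h] = b`!%:R * c`!%:R / (b + c).+1`!%:R * h ^+ (b + c).+1].
Proof.
have kb m : (m.+1%:R^-1)%:P * m.+1%:R = 1 :> {poly R}.
  by rewrite -polyC_natr -polyCM mulVf // pnatr_eq0.
elim: c b => [|c IH] b.
  exists ((b.+1%:R)^-1 *: 'X^(b.+1)); split.
  - by rewrite derivZ derivXn -mul_polyC /= -[RHS]mul1r -(kb b); ring.
  - by rewrite hornerE hornerXn expr0n /= mulr0.
  - rewrite hornerE hornerXn addn0 fact0 mulr1 factS natrM; congr (_ * _).
    by rewrite invfM mulrCA mulfV ?mulr1// pnatr_eq0 -lt0n fact_gt0.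
have [P [dP P0 Ph]] := IH b.+1.
have b1 : b.+1%:R != 0 :> R by rewrite pnatr_eq0.
exists ((b.+1%:R)^-1 *: ('X^(b.+1) * (h%:P - 'X) ^+ c.+1 + c.+1%:R *: P)); split.
- rewrite derivZ derivD derivM derivXn deriv_exp derivB derivC derivX derivZ dP.
  rewrite -!mul_polyC polyC_natr -[RHS]mul1r -(kb b) /=; ring.
- by rewrite !hornerE P0 expr0n /= mul0r add0r mulr0 mulr0.
- rewrite !hornerE Ph subrr [0 ^+ _]exprS mul0r mulr0 add0r.
  have : ((b + c).+2)`!%:R != 0 :> R by rewrite pnatr_eq0 -lt0n fact_gt0.
  rewrite addnS addSn; move: (_.+2`!%:R) => N N0.
  rewrite (factS b) (factS c) !natrM; field.
  by rewrite N0 nat1r b1.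
Qed.

Lemma integral_deriv_poly (R : realType) (p : {poly R}) (a b : R) : a <= b ->
  (\int[lebesgue_measure]_(x in `[a, b]) (p^`().[x])%:E = (p.[b] - p.[a])%:E)%E.
Proof.
rewrite le_eqVlt => /predU1P[->|ab].
  by rewrite set_itv1 integral_set1 subrr.
rewrite (@continuous_FTC2 _ _ (horner p)) ?EFinB //.
- by apply/continuous_subspaceT => x; exact: continuous_horner.
- split=> [x _| |].
  + exact: derivable_horner.
  + by apply: cvg_at_right_filter; exact: continuous_horner.
  + by apply: cvg_at_left_filter; exact: continuous_horner.
- by move=> x _; rewrite -derivE.
Qed.

Lemma integral_beta (R : realType) (h : R) (b c : nat) : 0 <= h ->
  (\int[lebesgue_measure]_(x in `[0%R, h]) (x ^+ b * (h - x) ^+ c)%R%:E =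
   (b`!%:R * c`!%:R / (b + c).+1`!%:R * h ^+ (b + c).+1)%R%:E)%E.
Proof.
move=> h0; have [P [dP P0 Ph]] := poly_beta_primitive h b c.
rewrite -Ph -[P.[h]]subr0 -[X in P.[h] - X]P0 -integral_deriv_poly // dP.
by under [RHS]eq_integral do rewrite !hornerE.
Qed.

Local Notation plane R := (measurableTypeR R * measurableTypeR R)%type.

(** The affine parametrization used in the surface integral puts the vertices
    0, 1, 2 of the face at (0, 0), (1, 0) and (0, 1). *)
Definition triangle_coord (R : realType) (j : 'I_3) (s : R * R) : R :=
  [:: 1 - s.1 - s.2; s.1; s.2]`_j.

Lemma sum_triangle_coord (R : realType) (s : R * R) :
  \sum_j triangle_coord j s = 1.
Proof. by rewrite !big_ord_recr big_ord0 /triangle_coord /=; ring. Qed.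

Lemma reference_triangleP (R : realType) (s : R * R) :
  reference_triangle s <-> forall j, 0 <= triangle_coord j s.
Proof.
split=> [[s1 s2 s12] j|H].
  case: j => [[|[|[|//]]] ?]; rewrite /triangle_coord //=.
  by rewrite -addrA -opprD subr_ge0.
split; first exact: (H (lift ord0 ord0)); first exact: (H ord_max).
by have := H ord0; rewrite /triangle_coord /= -addrA -opprD subr_ge0.
Qed.

Lemma measurable_triangle_coord (R : realType) (j : 'I_3) :
  measurable_fun (T := plane R) setT (@triangle_coord R j).
Proof.
case: j => [[|[|[|//]]] ?]; rewrite /triangle_coord /=;
  [|exact: measurable_fst|exact: measurable_snd].
apply: measurable_funB; last exact: measurable_snd.
by apply: measurable_funB; [exact: measurable_cst|exact: measurable_fst].
Qed.

Lemma measurable_nonneg (d : measure_display) (T : measurableType d)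
    (R : realType) (I : finType) (f : I -> T -> R) :
  (forall i, measurable_fun setT (f i)) ->
  measurable [set x | forall i, 0 <= f i x].
Proof.
move=> mf; rewrite (_ : [set _ | _] = \bigcap_(i in [set: I]) (f i @^-1` `[0, +oo[)).
  apply: fin_bigcap_measurable => // i _; rewrite -[_ @^-1` _]setTI.
  by apply: mf => //; exact: measurable_itv.
apply/seteqP; split=> x /= H i; first by move=> _; rewrite /= in_itv /= andbT.
by have := H i Logic.I; rewrite /= in_itv /= andbT.
Qed.

Lemma measurable_reference_triangle (R : realType) :
  @measurable _ (plane R) (@reference_triangle R).
Proof.
rewrite (_ : @reference_triangle R = [set s | forall j, 0 <= triangle_coord j s]).
  by apply: measurable_nonneg => j; exact: measurable_triangle_coord.
by apply/seteqP; split=> s /reference_triangleP.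
Qed.

Lemma reference_triangle_fin (R : realType) :
  ((lebesgue_measure \x lebesgue_measure) (@reference_triangle R) < +oo)%E.
Proof.
apply: (@le_lt_trans _ _
  ((lebesgue_measure \x lebesgue_measure)%E (`[0, 1%R] `*` `[0, 1%R] : set (R * R)))).
  apply: le_measure; rewrite ?inE //.
  - exact: measurable_reference_triangle.
  - by apply: measurableX; exact: measurable_itv.
  - move=> [x y] [/= x0 y0 xy]; rewrite /= !in_itv /= x0 y0; split; lra.
rewrite product_measure1E //=.
by rewrite !lebesgue_measure_itv /= lte_fin ltr01 -EFinB subr0 mule1 ltry.
Qed.

Lemma bounded_triangle_coord (R : realType) (j : 'I_3) :
  bounded_measurable (T := plane R) (@reference_triangle R) (@triangle_coord R j).
Proof.
split.
  apply: measurable_funS (@measurable_triangle_coord R j) => //.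
exists 1 => s /reference_triangleP H.
rewrite ger0_norm // -(sum_triangle_coord s) (bigD1 j) //= lerDl.
exact: sumr_ge0.
Qed.

(** Up to the constant surface element, the integral over any triangle in space
    parametrized by the reference triangle. *)
Definition reference_integral (R : realType) (f : R * R -> R) : R :=
  \int[(lebesgue_measure \x lebesgue_measure)%E]_(s in @reference_triangle R) f s.

Lemma reference_integral_linear (R : realType) (f g : R * R -> R) (c : R) :
  bounded_measurable (T := plane R) (@reference_triangle R) f ->
  bounded_measurable (T := plane R) (@reference_triangle R) g ->
  reference_integral (fun s => c * f s + g s) =
  c * reference_integral f + reference_integral g.
Proof.
move=> bf bg; apply: Rintegral_linear => //.
- exact: measurable_reference_triangle.
- exact: reference_triangle_fin.
Qed.

Definition triangle_monomial (R : realType) (a : 'I_3 -> nat) (s : R * R) : R :=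
  \prod_j triangle_coord j s ^+ a j.

Lemma bounded_triangle_monomial (R : realType) (a : 'I_3 -> nat) :
  bounded_measurable (T := plane R) (@reference_triangle R) (triangle_monomial a).
Proof.
rewrite /triangle_monomial.
pose p : mpoly 3 R := \prod_j mpolyX R (mnm1 j) ^+ a j.
rewrite (_ : (fun _ => _) = fun s => meval (fun j => triangle_coord j s) p).
  apply: meval_closed_ind.
  - exact: bounded_measurable_cst.
  - exact: bounded_measurableD.
  - exact: bounded_measurableM.
  - exact: bounded_triangle_coord.
apply/funext => s; rewrite rmorph_prod; apply: eq_bigr => j _.
by rewrite rmorphXn /= mevalXU.
Qed.

(** Dirichlet's formula. Integrating first along a vertical segment of length
    1 - x and then over x gives two Beta integrals in succession. *)
Lemma reference_integral_monomial (R : realType) (a : 'I_3 -> nat) :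
  reference_integral (@triangle_monomial R a) =
  (\prod_j (a j)`!)%:R / ((\sum_j a j).+2)`!%:R.
Proof.
rewrite /triangle_monomial; set f := fun s => _; set mu := @lebesgue_measure R.
have := bounded_measurable_integrable (@measurable_reference_triangle R)
  (@reference_triangle_fin R) (@bounded_triangle_monomial R a).
move/(integrable_mkcond _ (@measurable_reference_triangle R)) => intf.
rewrite /reference_integral /Rintegral integral_mkcond -(integral12_prod_meas1 intf).
rewrite /fubini_F.
set p := a ord0; set q := a (lift ord0 ord0); set r := a (lift ord0 (lift ord0 ord0)).
have inner (x : R) :
    (\int[mu]_y ((EFin \o f) \_ (@reference_triangle R)) (x, y) =
     ((fun x => (r`!%:R * p`!%:R / (r + p).+1`!%:R *
        (x ^+ q * (1 - x) ^+ (r + p).+1))%R%:E) \_ `[0%R, 1%R]) x)%E.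
  have [|x01] := boolP (x \in `[0%R, 1%R]).
    rewrite in_itv /= => /andP[x0 x1].
    rewrite patchE mem_set /= ?in_itv /= ?x0 //.
    transitivity (\int[mu]_(y in `[0%R, (1 - x)%R])
      ((x ^+ q)%:E * (y ^+ r * (1 - x - y) ^+ p)%:E))%E.
      rewrite [RHS]integral_mkcond; apply: eq_integral => y _.
      rewrite !patchE.
      have -> : ((x, y) \in @reference_triangle R) = (y \in `[0%R, (1 - x)%R]).
        apply/idP/idP.
          by move=> /set_mem[/= _ y0 xy]; rewrite in_itv /= y0; lra.
        rewrite in_itv /= => /andP[y0 y1]; apply/mem_set; split=> //=; lra.
      rewrite mem_setE; case: ifP => // _.
      rewrite /= /f !big_ord_recl big_ord0 mulr1 /triangle_coord /= -/p -/q -/r.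
      by rewrite -EFinM mulrCA [X in _ * X]mulrC.
    rewrite ge0_integralZl_EFin //.
    - by rewrite integral_beta ?subr_ge0 // -EFinM mulrCA.
    - move=> y; rewrite /= in_itv /= => /andP[y0 y1].
      by rewrite lee_fin mulr_ge0 // exprn_ge0 // subr_ge0.
    - apply/measurable_EFinP; apply: measurable_funM.
        exact: measurable_funX.
      apply: measurable_funX.
      exact: measurable_funB.
    - exact: exprn_ge0.
  (* Outside [0, 1] the vertical section of the triangle is empty. *)
  move/negP: x01 => x01; rewrite [RHS]patchE memNset // integral0_eq // => y _.
  rewrite patchE memNset // => -[/= x0 y0 xy]; apply: x01.
  rewrite in_itv /= x0; lra.
under eq_integral do rewrite inner.
rewrite -integral_mkcond.
under eq_integral do rewrite EFinM.
rewrite ge0_integralZl_EFin //; first last.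
- apply/measurable_EFinP; apply: measurable_funM.
    exact: measurable_funX.
  apply: measurable_funX.
  exact: measurable_funB.
- move=> x; rewrite /= in_itv /= => /andP[x0 x1].
  by rewrite lee_fin mulr_ge0 // exprn_ge0 // subr_ge0.
rewrite integral_beta // -EFinM /= expr1n mulr1.
rewrite !big_ord_recl !big_ord0 muln1 addn0 -/p -/q -/r (natrM _ p`!) (natrM _ q`!).
have -> : (q + (r + p).+1).+1 = (p + (q + r)).+2 by lia.
have F n : n`!%:R != 0 :> R by rewrite pnatr_eq0 -lt0n fact_gt0.
move: (F p) (F q) (F r) (F (r + p).+1) (F (p + (q + r)).+2).
move: p`!%:R q`!%:R r`!%:R (r + p).+1`!%:R (p + (q + r)).+2`!%:R => P Q S V W.
by move=> P0 Q0 S0 V0 W0; field; rewrite V0 W0.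
Qed.

(** * Polynomials on the triangle as barycentric forms *)

Lemma triangle_monomialM (R : realType) (a b : 'I_3 -> nat) (s : R * R) :
  triangle_monomial a s * triangle_monomial b s =
  triangle_monomial (fun j => a j + b j)%N s.
Proof. by rewrite -big_split; apply: eq_bigr => j _; rewrite exprD. Qed.

Lemma triangle_coordX (R : realType) (i : 'I_3) (n : nat) (s : R * R) :
  triangle_coord i s ^+ n = triangle_monomial (fun j => n * (j == i))%N s.
Proof.
rewrite /triangle_monomial (bigD1 i) //= eqxx muln1 big1 ?mulr1 // => j /negPf ->.
by rewrite muln0.
Qed.

Lemma triangle_coord_monomial (R : realType) (i : 'I_3) (s : R * R) :
  triangle_coord i s = triangle_monomial (fun j => j == i : nat) s.
Proof.
rewrite -[LHS]expr1 triangle_coordX.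
by apply: eq_bigr => j _; rewrite mul1n.
Qed.

Lemma eq_reference_integral (R : realType) (f g : R * R -> R) :
  (forall s, reference_triangle s -> f s = g s) ->
  reference_integral f = reference_integral g.
Proof. by move=> fg; apply: eq_Rintegral => s /set_mem/fg. Qed.

Lemma reference_integral0 (R : realType) : reference_integral (fun=> 0 : R) = 0.
Proof.
rewrite /reference_integral Rintegral_cst ?mul0r //.
exact: measurable_reference_triangle.
Qed.

Lemma reference_integralZ (R : realType) (f : R * R -> R) (c : R) :
  bounded_measurable (T := plane R) (@reference_triangle R) f ->
  reference_integral (fun s => c * f s) = c * reference_integral f.
Proof.
move=> bf; rewrite -[RHS]addr0 -(reference_integral0 R).
rewrite -reference_integral_linear //; last exact: bounded_measurable_cst.
by congr reference_integral; apply/funext => s; rewrite addr0.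
Qed.

Lemma reference_integral_sum (R : realType) (I : Type) (r : seq I) (c : I -> R)
    (F : I -> R * R -> R) :
  (forall i, bounded_measurable (T := plane R) (@reference_triangle R) (F i)) ->
  reference_integral (fun s => \sum_(i <- r) c i * F i s) =
  \sum_(i <- r) c i * reference_integral (F i).
Proof.
move=> bF; elim: r => [|i r IH].
  under eq_fun do rewrite big_nil.
  by rewrite big_nil reference_integral0.
under eq_fun do rewrite big_cons.
rewrite big_cons reference_integral_linear // ?IH //.
apply: bounded_measurable_sum => j; apply: bounded_measurableM => //.
exact: bounded_measurable_cst.
Qed.

(** Forms of degree d in the barycentric coordinates. Since the coordinates sum
    to 1, these are the polynomials of degree at most d; the recursion makes both
    the multiplication by affine functions and induction on d immediate. *)
Fixpoint triangle_form (R : realType) (d : nat) (f : R * R -> R) : Prop :=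
  if d is d'.+1 then
    exists2 g : 'I_3 -> R * R -> R, forall j, triangle_form d' (g j) &
      f = fun s => \sum_j triangle_coord j s * g j s
  else exists c, f = fun=> c.

Section TriangleForms.
Variable R : realType.
Implicit Types f g q : R * R -> R.

Lemma triangle_formD d f g :
  triangle_form d f -> triangle_form d g -> triangle_form d (fun s => f s + g s).
Proof.
elim: d f g => [|d IH] f g /=; first by move=> [c ->] [e ->]; exists (c + e).
move=> [f' Hf ->] [g' Hg ->]; exists (fun j s => f' j s + g' j s).
  by move=> j; apply: IH.
by apply/funext => s; rewrite -big_split; apply: eq_bigr => j _; rewrite mulrDr.
Qed.

Lemma triangle_formZ d f c :
  triangle_form d f -> triangle_form d (fun s => c * f s).
Proof.
elim: d f => [|d IH] f /=; first by move=> [e ->]; exists (c * e).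
move=> [f' Hf ->]; exists (fun j s => c * f' j s); first by move=> j; apply: IH.
by apply/funext => s; rewrite mulr_sumr; apply: eq_bigr => j _; rewrite mulrCA.
Qed.

Lemma triangle_form_affineM d f (b : 'I_3 -> R) : triangle_form d f ->
  triangle_form d.+1 (fun s => (\sum_j triangle_coord j s * b j) * f s).
Proof.
move=> Hf; exists (fun j s => b j * f s) => [j|]; first exact: triangle_formZ.
by apply/funext => s; rewrite mulr_suml; apply: eq_bigr => j _; rewrite mulrA.
Qed.

(** Homogenization: multiply by the sum of the coordinates, which is 1. *)
Lemma triangle_formS d f : triangle_form d f -> triangle_form d.+1 f.
Proof.
move=> /(@triangle_form_affineM d f (fun=> 1)); congr (triangle_form _ _).
apply/funext => s; rewrite -mulr_suml sum_triangle_coord.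
by rewrite !mul1r.
Qed.

Lemma bounded_triangle_form d f : triangle_form d f ->
  bounded_measurable (T := plane R) (@reference_triangle R) f.
Proof.
elim: d f => [|d IH] f /=.
  by move=> [c ->]; exact: bounded_measurable_cst.
move=> [g Hg ->]; apply: bounded_measurable_sum => j.
by apply: bounded_measurableM; [exact: bounded_triangle_coord|exact: IH].
Qed.

(** Orthogonality to all forms of degree d only has to be tested on monomials;
    the induction moves one coordinate at a time from the form into f. *)
Lemma reference_integral_form_eq0 d f :
  bounded_measurable (T := plane R) (@reference_triangle R) f ->
  (forall a : 'I_3 -> nat, (\sum_j a j)%N = d ->
     reference_integral (fun s => f s * triangle_monomial a s) = 0) ->
  forall q, triangle_form d q -> reference_integral (fun s => f s * q s) = 0.
Proof.
elim: d f => [|d IH] f bf Hf q /=.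
  move=> [c ->]; under eq_fun do rewrite mulrC.
  rewrite reference_integralZ // -[X in reference_integral X](_ : (fun s =>
    f s * triangle_monomial (fun=> 0%N) s) = f) ?Hf ?mulr0 //.
    by rewrite big1.
  by apply/funext => s; rewrite /triangle_monomial big1 ?mulr1.
move=> [g Hg ->].
have bfc j : bounded_measurable (T := plane R) (@reference_triangle R)
    (fun s => f s * triangle_coord j s).
  by apply: bounded_measurableM => //; exact: bounded_triangle_coord.
rewrite (_ : (fun _ => _) =
    fun s => \sum_j 1 * ((f s * triangle_coord j s) * g j s)); last first.
  apply/funext => s; rewrite mulr_sumr; apply: eq_bigr => j _.
  by rewrite mul1r mulrA.
rewrite reference_integral_sum => [|j]; last first.
  by apply: bounded_measurableM => //; exact: bounded_triangle_form (Hg j).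
rewrite big1 // => j _; rewrite mul1r IH // => a sa.
under eq_fun do rewrite -mulrA triangle_coord_monomial triangle_monomialM.
apply: Hf; rewrite big_split /= sa (bigD1 j) //= eqxx big1 // => i /negPf -> //.
Qed.

End TriangleForms.

(** * Radau polynomials along an edge *)

(** For x + y = 1 this is, up to a constant factor, the sum of the Legendre
    polynomials of degrees k and k+1 of [0, 1]. Being the combination that vanishes
    at x = 0, it is a multiple of x; it is orthogonal to all polynomials of degree
    less than k on [0, 1]. *)
Definition radau (R : pzRingType) (k : nat) (x y : R) : R :=
  \sum_(i < k.+1) (-1) ^+ i * ('C(k, i) * 'C(k.+1, i))%:R * x ^+ (k.+1 - i) * y ^+ i.

Lemma radau0r (R : comPzRingType) (k : nat) (x : R) : radau k x 0 = x ^+ k.+1.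
Proof.
rewrite /radau big_ord_recl big1 => [|i _]; last by rewrite expr0n mulr0.
by rewrite !bin0 !expr0 !mul1r mulr1 addr0.
Qed.

Lemma radau0l (R : comPzRingType) (k : nat) (y : R) : radau k 0 y = 0.
Proof.
rewrite /radau big1 // => i _.
by rewrite expr0n subn_eq0 leqNgt ltn_ord mulr0 mul0r.
Qed.

Lemma rmorph_radau (R S : pzRingType) (f : {rmorphism R -> S}) (k : nat) (x y : R) :
  f (radau k x y) = radau k (f x) (f y).
Proof.
rewrite rmorph_sum; apply: eq_bigr => i _.
by rewrite 3!rmorphM rmorph_sign rmorph_nat !rmorphXn.
Qed.

(** Orthogonality of the Radau polynomial to x^A y^B in terms of factorials. The
    sum is a finite computation with integers, since A and B are at most 2. *)
Lemma radau_moment (R : pzRingType) (k A B : nat) : k = 2%N \/ k = 3%N ->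
  (A + B <= k.-1)%N ->
  \sum_(i < k.+1) (-1) ^+ i *
    ('C(k, i) * 'C(k.+1, i) * ((k.+1 - i + A)`! * (i + B)`!))%:R = 0 :> R.
Proof.
move=> hk hAB.
have E : \sum_(i < k.+1) (-1) ^+ i *
    ('C(k, i) * 'C(k.+1, i) * ((k.+1 - i + A)`! * (i + B)`!))%:R = 0 :> int.
  have hA : (A <= 2)%N by case: hk hAB => ->; lia.
  have hB : (B <= 2)%N by case: hk hAB => ->; lia.
  case: hk hAB => -> /=; rewrite !big_ord_recl big_ord0;
    case: A hA => [|[|[|//]]] _; case: B hB => [|[|[|//]]] _ // _;
    vm_compute; reflexivity.
have /(congr1 (intmul (1 : R))) := E.
rewrite rmorph_sum /= mulr0z => E'; rewrite -[RHS]E'; apply: eq_bigr => i _.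
by rewrite intrM rmorph_sign rmorph_nat.
Qed.

Section TriangleOrthogonality.
Variable R : realType.

Lemma bounded_radau k (x y : 'I_3) :
  bounded_measurable (T := plane R) (@reference_triangle R)
    (fun s => radau k (triangle_coord x s) (triangle_coord y s)).
Proof.
apply: bounded_measurable_sum => i.
rewrite (_ : (fun _ => _) = fun s => (-1) ^+ i * ('C(k, i) * 'C(k.+1, i))%:R *
  triangle_monomial (fun j => (k.+1 - i) * (j == x) + i * (j == y))%N s).
  apply: bounded_measurableM; first exact: bounded_measurable_cst.
  exact: bounded_triangle_monomial.
by apply/funext => s; rewrite !triangle_coordX -mulrA triangle_monomialM.
Qed.

(** With r = lambda_x + lambda_y and lambda_x = r t, a monomial of degree less
    than k splits into a function of r times t^A (1 - t)^B with A + B < k, so the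
    integral over the triangle is a multiple of the one over the edge. *)
Lemma radau_orthogonal k (x y : 'I_3) (q : R * R -> R) :
  k = 2%N \/ k = 3%N -> x != y -> triangle_form k.-1 q ->
  reference_integral (fun s =>
    radau k (triangle_coord x s) (triangle_coord y s) * q s) = 0.
Proof.
move=> hk xy; apply: reference_integral_form_eq0; first exact: bounded_radau.
move=> a sa.
have yx : (y == x) = false by rewrite eq_sym; apply: negPf.
(* The exponents in the product of the i-th term by the test monomial. *)
pose e (i : 'I_k.+1) j := ((k.+1 - i) * (j == x) + (i * (j == y) + a j))%N.
rewrite (_ : (fun _ => _) = fun s => \sum_(i < k.+1)
    ((-1) ^+ i * ('C(k, i) * 'C(k.+1, i))%:R) * triangle_monomial (e i) s); last first.
  apply/funext => s; rewrite mulr_suml; apply: eq_bigr => i _.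
  by rewrite !triangle_coordX -!mulrA !triangle_monomialM.
rewrite reference_integral_sum => [|i]; last exact: bounded_triangle_monomial.
have se i : (\sum_j e i j = k.+1 + k.-1)%N.
  rewrite big_split /= big_split /= sa -!big_distrr /=.
  rewrite (bigD1 x) //= eqxx big1 => [|j /negPf -> //].
  rewrite (bigD1 y) //= eqxx big1 => [|j /negPf -> //].
  by rewrite !addn0 !muln1 addnA subnK // ltnW.
pose N := (\prod_(j | (j != x) && (j != y)) (a j)`!)%N.
rewrite (eq_bigr (fun i : 'I_k.+1 => ((-1) ^+ i *
    ('C(k, i) * 'C(k.+1, i) * ((k.+1 - i + a x)`! * (i + a y)`!))%:R) *
    (N%:R / (k.+1 + k.-1).+2`!%:R))).
  rewrite -mulr_suml radau_moment ?mul0r //.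
  rewrite -sa (bigD1 x) //= (bigD1 y) 1?eq_sym //= addnA leq_addr //.
move=> i _; rewrite reference_integral_monomial se.
rewrite (bigD1 x) //= (bigD1 y) 1?eq_sym //= /e eqxx eqxx yx (negPf xy).
rewrite !muln0 !muln1 !add0n.
rewrite (_ : (\prod_(j | _) _)%N = N); last first.
  by apply: eq_bigr => j /andP[/negPf -> /negPf ->]; rewrite !muln0.
move: (_.+2)`! => W; rewrite !natrM; ring.
Qed.

End TriangleOrthogonality.

(** * Nondegeneracy of the face pairing *)

Section TriangleNondegeneracy.
Variable R : realType.

Lemma reference_integral_monomial_form (n : nat) (a : 'I_3 -> nat)
    (I : finType) (c : I -> R) (b : I -> 'I_3 -> nat) :
  (forall i, \sum_j b i j = n)%N ->
  reference_integral (fun s =>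
    triangle_monomial a s * \sum_i c i * triangle_monomial (b i) s) =
  (\sum_i c i * (\prod_l (a l + b i l)`!)%:R) / (\sum_j a j + n).+2`!%:R.
Proof.
move=> sb; rewrite (_ : (fun _ => _) = fun s =>
    \sum_i c i * triangle_monomial (fun l => a l + b i l)%N s); last first.
  apply/funext => s; rewrite mulr_sumr; apply: eq_bigr => i _.
  by rewrite mulrCA triangle_monomialM.
rewrite reference_integral_sum => [|j]; last exact: bounded_triangle_monomial.
rewrite mulr_suml; apply: eq_bigr => i _.
by rewrite reference_integral_monomial -mulrA big_split /= sb.
Qed.

Lemma reference_integral_monomial_form_eq0 (n : nat) (a : 'I_3 -> nat)
    (I : finType) (c : I -> R) (b : I -> 'I_3 -> nat) :
  (forall i, \sum_j b i j = n)%N ->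
  reference_integral (fun s =>
    triangle_monomial a s * \sum_i c i * triangle_monomial (b i) s) = 0 ->
  \sum_i c i * (\prod_l (a l + b i l)`!)%:R = 0.
Proof.
move=> sb; rewrite (reference_integral_monomial_form _ _ sb) => /eqP.
by rewrite mulf_eq0 invr_eq0 pnatr_eq0 -leqn0 leqNgt fact_gt0 orbF => /eqP.
Qed.

Lemma triangle_form1E (q : R * R -> R) : triangle_form 1 q -> exists c : 'I_3 -> R,
  q = fun s => \sum_i c i * triangle_monomial (fun l => l == i : nat) s.
Proof.
move=> [g Hg ->]; have /choice[c Hc] := Hg; exists c; apply/funext => s.
by apply: eq_bigr => i _; rewrite Hc mulrC triangle_coord_monomial.
Qed.

(** The coefficients are indexed by ordered pairs, so that each mixed monomial
    occurs twice and only the sum of its two coefficients is determined. *)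
Lemma triangle_form2E (q : R * R -> R) : triangle_form 2 q ->
  exists c : 'I_3 * 'I_3 -> R, q = fun s => \sum_ij c ij *
    triangle_monomial (fun l => (l == ij.1) + (l == ij.2))%N s.
Proof.
move=> [g Hg ->].
have /choice[c Hc] : forall i, exists c : 'I_3 -> R,
  g i = fun s => \sum_j c j * triangle_monomial (fun l => l == j : nat) s.
  by move=> i; apply: triangle_form1E.
exists (fun ij => c ij.1 ij.2); apply/funext => s.
rewrite -(pair_bigA _ (fun i j => c i j *
  triangle_monomial (fun l => (l == i) + (l == j))%N s)) /=; apply: eq_bigr => i _.
rewrite Hc mulr_sumr; apply: eq_bigr => j _.
by rewrite triangle_coord_monomial mulrCA triangle_monomialM.
Qed.

Lemma sum_ord3 (F : 'I_3 -> R) :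
  \sum_i F i = F ord0 + F (lift ord0 ord0) + F (lift ord0 (lift ord0 ord0)).
Proof. by rewrite !big_ord_recl big_ord0 addr0 addrA. Qed.

Lemma sum_ord3x3 (F : 'I_3 * 'I_3 -> R) :
  \sum_ij F ij = \sum_i \sum_j F (i, j).
Proof. by rewrite pair_bigA; apply: eq_bigr => -[]. Qed.

Lemma prod_ord3 (F : 'I_3 -> nat) :
  (\prod_l F l = F ord0 * F (lift ord0 ord0) * F (lift ord0 (lift ord0 ord0)))%N.
Proof. by rewrite !big_ord_recl big_ord0 muln1 mulnA. Qed.

Lemma sum_delta (i : 'I_3) : (\sum_j (j == i) = 1)%N.
Proof. by rewrite (bigD1 i) //= eqxx big1 // => j /negPf ->. Qed.

Lemma triangle_form1_nondegenerate (q : R * R -> R) : triangle_form 1 q ->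
  (forall i, reference_integral (fun s => triangle_coord i s ^+ 3 * q s) = 0) ->
  reference_integral (fun s => triangle_monomial (fun=> 1%N) s * q s) = 0 ->
  forall s, q s = 0.
Proof.
move=> /triangle_form1E[c ->] Hv Hb s.
have {}Hv i : \sum_j c j * (\prod_l (3 * (l == i) + (l == j))`!)%:R = 0.
  have := Hv i; under eq_fun do rewrite triangle_coordX.
  exact: reference_integral_monomial_form_eq0 sum_delta.
have {}Hb : \sum_j c j * (\prod_l (1 + (l == j))`!)%:R = 0.
  exact: reference_integral_monomial_form_eq0 sum_delta Hb.
have H0 := Hv ord0; have H1 := Hv (lift ord0 ord0).
have H2 := Hv (lift ord0 (lift ord0 ord0)).
move: H0 H1 H2 Hb; rewrite !sum_ord3 !prod_ord3 /=.
rewrite !(muln0, muln1, mul1n, add0n, addn0).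
have -> : (3 + 1)`! = 24%N by [].
have -> : 3`! = 6%N by [].
have -> : (1 + 1)`! = 2%N by [].
move: (c _) (c _) (c _) => z y x Hx Hy Hz Hb.
have -> : x = 0 by lra.
have -> : y = 0 by lra.
have -> : z = 0 by lra.
by rewrite !mul0r !addr0.
Qed.

Lemma triangle_form2_nondegenerate (q : R * R -> R) : triangle_form 2 q ->
  (forall i, reference_integral (fun s => triangle_coord i s ^+ 4 * q s) = 0) ->
  (forall i : 'I_3, reference_integral (fun s =>
     triangle_monomial (fun j => (j == i).+1) s * q s) = 0) ->
  forall s, q s = 0.
Proof.
move=> /triangle_form2E[c ->] Hv Hb s.
have sum_delta2 (ij : 'I_3 * 'I_3) : (\sum_j ((j == ij.1) + (j == ij.2)) = 2)%N.
  by rewrite big_split /= !sum_delta.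
have {}Hv i : \sum_ij c ij *
    (\prod_l (4 * (l == i) + ((l == ij.1) + (l == ij.2)))`!)%:R = 0.
  have := Hv i; under eq_fun do rewrite triangle_coordX.
  exact: reference_integral_monomial_form_eq0 sum_delta2.
have {}Hb i : \sum_ij c ij *
    (\prod_l ((l == i).+1 + ((l == ij.1) + (l == ij.2)))`!)%:R = 0.
  exact: (reference_integral_monomial_form_eq0 sum_delta2 (Hb i)).
have factE : ((6`! = 720%N) * (5`! = 120%N) * (4`! = 24%N) * (3`! = 6%N) *
  (2`! = 2%N) * (1`! = 1%N) * (0`! = 1%N))%type by [].
have /[!(sum_ord3x3, sum_ord3, prod_ord3)]/= H0 := Hv ord0.
have /[!(sum_ord3x3, sum_ord3, prod_ord3)]/= H1 := Hv (lift ord0 ord0).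
have /[!(sum_ord3x3, sum_ord3, prod_ord3)]/= H2 := Hv (lift ord0 (lift ord0 ord0)).
have /[!(sum_ord3x3, sum_ord3, prod_ord3)]/= B0 := Hb ord0.
have /[!(sum_ord3x3, sum_ord3, prod_ord3)]/= B1 := Hb (lift ord0 ord0).
have /[!(sum_ord3x3, sum_ord3, prod_ord3)]/= B2 := Hb (lift ord0 (lift ord0 ord0)).
move: H0 H1 H2 B0 B1 B2.
rewrite !(muln0, muln1, add0n, addn0, add1n, addn1, addn2).
rewrite !factE !(muln1, mul1n, natrM).
rewrite -!triangle_monomialM -!triangle_coord_monomial.
move: (c (_, _)) (c (_, _)) (c (_, _)) (c (_, _)) (c (_, _)) (c (_, _))
  (c (_, _)) (c (_, _)) (c (_, _)) => c22 c21 c20 c12 c11 c10 c02 c01 c00.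
move: (triangle_coord _ _) (triangle_coord _ _) (triangle_coord _ _) => z y x.
move=> H0 H1 H2 B0 B1 B2.
have E0 : c00 = 0 by lra.
have E1 : c11 = 0 by lra.
have E2 : c22 = 0 by lra.
have E3 : c01 = - c10 by lra.
have E4 : c02 = - c20 by lra.
have E5 : c12 = - c21 by lra.
by rewrite E0 E1 E2 E3 E4 E5; ring.
Qed.

(** This is where k must be small: for k = 4 the functionals would number
    3 + 6 = 9, while P_3 has dimension 10. *)
Lemma triangle_form_nondegenerate k (q : R * R -> R) : k = 2%N \/ k = 3%N ->
  triangle_form k.-1 q ->
  (forall i, reference_integral (fun s => triangle_coord i s ^+ k.+1 * q s) = 0) ->
  (forall a : 'I_3 -> nat, (\sum_j a j = k.-2)%N ->
     reference_integral (fun s => triangle_monomial (fun j => (a j).+1) s * q s) = 0) ->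
  forall s, q s = 0.
Proof.
case=> -> Hq Hv Hb.
  by apply: triangle_form1_nondegenerate => //; apply: (Hb (fun=> 0%N)); rewrite big1.
apply: triangle_form2_nondegenerate => // i.
by apply: (Hb (fun j => j == i : nat)); exact: sum_delta.
Qed.

End TriangleNondegeneracy.

(** * Duality between functionals and interpolation *)

(** Take in V a row space, of a matrix A, of maximal dimension. If A is
    not of full rank, some nonzero column kills A, and a vector of V that this
    column does not kill enlarges A. *)
Lemma subspace_fullP (F : fieldType) (n : nat) (V : set 'rV[F]_n) :
  V 0 -> (forall c x y, V x -> V y -> V (c *: x + y)) ->
  (forall u : 'cV[F]_n, (forall x, V x -> x *m u = 0) -> u = 0) ->
  forall x, V x.
Proof.
move=> V0 VL Vnd.
pose P r := `[< exists2 A : 'M[F]_n, \rank A = r &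
  forall x : 'rV_n, (x <= A)%MS -> V x >].
have P0 : exists r, P r.
  exists 0%N; apply/asboolP; exists 0; first exact: mxrank0.
  by move=> x; rewrite submx0 => /eqP ->.
have Pn r : P r -> (r <= n)%N by move=> /asboolP[A <- _]; exact: rank_leq_row.
have [r /asboolP[A rA VA] rmax] := ex_maxnP P0 Pn.
move=> x; have [fA|Anf] := boolP (row_full A); first exact: VA _ (submx_full x fA).
suff [y Vy yA] : exists2 y, V y & ~~ (y <= A)%MS.
  suff : P (\rank (A + y)%MS).
    move=> /rmax; rewrite leqNgt -rA => /negP[]; apply: rank_ltmx.
    by rewrite ltmxE addsmxSl addsmx_sub submx_refl.
  apply/asboolP; exists (A + y)%MS => // z /sub_addsmxP[[z1 z2] /= ->].
  rewrite addrC [z2]mx11_scalar mul_scalar_mx.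
  by apply: VL => //; apply: VA; exact: submxMl.
apply: contrapT => H; move/negP: Anf; apply.
rewrite -cokermx_eq0; apply/eqP/matrixP => i j; rewrite [RHS]mxE.
have : col j (cokermx A) = 0.
  apply: Vnd => y Vy; rewrite colE.
  have [/submxP[D ->]|yA] := boolP (y <= A)%MS; last by case: H; exists y.
  by rewrite -mulmxA [A *m _]mulmxA mulmx_coker mul0mx mulmx0.
by move/matrixP/(_ i 0); rewrite !mxE.
Qed.

(** The image of W under the n functionals is a subspace of F^n, and a vector
    orthogonal to it is a combination of the functionals that vanishes on W. *)
Lemma dual_interpolation (F : fieldType) (X : Type) (W : set (X -> F)) (n : nat)
    (l : 'I_n -> (X -> F) -> F) :
  W (fun=> 0) ->
  (forall c f g, W f -> W g -> W (fun x => c * f x + g x)) ->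
  (forall j c f g, W f -> W g -> l j (fun x => c * f x + g x) = c * l j f + l j g) ->
  (forall u : 'I_n -> F, (forall f, W f -> \sum_j u j * l j f = 0) ->
     forall j, u j = 0) ->
  forall alpha : 'I_n -> F, exists2 f, W f & forall j, l j f = alpha j.
Proof.
move=> W0 WL lL nd alpha.
pose V : set 'rV[F]_n := [set x | exists2 f, W f & x = \row_j l j f].
suff : V (\row_j alpha j).
  by move=> [f Wf /rowP E]; exists f => // j; have := E j; rewrite !mxE => ->.
apply: subspace_fullP.
- exists (fun=> 0) => //; apply/rowP => j; rewrite !mxE.
  have E : (fun=> 0) = (fun _ : X => -1 * 0 + 0 : F) by rewrite mulr0 addr0.
  by rewrite [X in l j X]E lL // mulN1r addNr.
- move=> c _ _ [f Wf ->] [g Wg ->]; exists (fun x => c * f x + g x).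
    exact: WL.
  by apply/rowP => j; rewrite !mxE lL.
- move=> u Vu; apply/colP => j; rewrite [RHS]mxE; apply: (nd (fun j => u j 0)).
  move=> f Wf; have /matrixP/(_ 0 0) := Vu _ (ex_intro2 _ _ f Wf erefl).
  rewrite !mxE => E; rewrite -[RHS]E.
  by apply: eq_bigr => i _; rewrite !mxE mulrC.
Qed.

Section LinearFunctional.
Variables (F : fieldType) (X : Type) (B : (X -> F) -> Prop) (I : (X -> F) -> F).
Hypothesis B0 : B (fun=> 0).
Hypothesis BL : forall c f g, B f -> B g -> B (fun x => c * f x + g x).
Hypothesis IL : forall c f g, B f -> B g ->
  I (fun x => c * f x + g x) = c * I f + I g.

Lemma closed_sum (J : Type) (r : seq J) (c : J -> F) (f : J -> X -> F) :
  (forall j, B (f j)) -> B (fun x => \sum_(j <- r) c j * f j x).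
Proof.
move=> Bf; elim: r => [|j r IH]; first by under eq_fun do rewrite big_nil.
by under eq_fun do rewrite big_cons; exact: BL.
Qed.

Lemma functional_sum (J : Type) (r : seq J) (c : J -> F) (f : J -> X -> F) :
  (forall j, B (f j)) ->
  I (fun x => \sum_(j <- r) c j * f j x) = \sum_(j <- r) c j * I (f j).
Proof.
move=> Bf; elim: r => [|j r IH].
  under eq_fun do rewrite big_nil.
  have E : (fun=> 0) = (fun _ : X => -1 * 0 + 0 : F) by rewrite mulr0 addr0.
  by rewrite big_nil E IL // mulN1r addNr.
under eq_fun do rewrite big_cons.
by rewrite IL ?IH ?big_cons //; exact: closed_sum.
Qed.

End LinearFunctional.

Lemma basis_independent (R : realType) (X : Type) (W : set (X -> R)) n (b : 'I_n -> X -> R)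
    (u : 'I_n -> R) :
  W (fun=> 0) -> is_basis W b -> (fun x => \sum_j u j * b j x) = (fun=> 0) ->
  forall j, u j = 0.
Proof.
move=> W0 [_ /(_ _ W0)[c [_ cU]]] u0 j.
have -> : u j = (\row_i u i) ord0 j by rewrite mxE.
rewrite -(cU (\row_i u i)) ?(cU 0) ?mxE //.
- by apply/funext => x; rewrite big1 // => i _; rewrite mxE mul0r.
- by rewrite -u0; apply/funext => x; apply: eq_bigr => i _; rewrite mxE.
Qed.

(** * Polynomials and barycentric coordinates in space *)

Section PolynomialDegree.
Variables (n : nat) (R : idomainType).
Implicit Types p q : mpoly n R.

Lemma msizeM_leD (d e : nat) p q : (mpoly.msize p <= d.+1)%N ->
  (mpoly.msize q <= e.+1)%N -> (mpoly.msize (p * q) <= (d + e).+1)%N.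
Proof.
move=> hp hq; have [->|p0] := eqVneq p 0; first by rewrite mul0r msize0.
have [->|q0] := eqVneq q 0; first by rewrite mulr0 msize0.
by rewrite msizeM //; lia.
Qed.

Lemma msizeX_leM (d k : nat) p : (mpoly.msize p <= d.+1)%N ->
  (mpoly.msize (p ^+ k) <= (k * d).+1)%N.
Proof.
move=> hp; elim: k => [|k IH]; first by rewrite expr0 msize1.
by rewrite exprS mulSn; apply: msizeM_leD.
Qed.

Lemma msize_sum_le (d : nat) (I : Type) (r : seq I) (F : I -> mpoly n R) :
  (forall i, (mpoly.msize (F i) <= d)%N) ->
  (mpoly.msize (\sum_(i <- r) F i) <= d)%N.
Proof.
move=> HF; elim: r => [|i r IH]; first by rewrite big_nil msize0.
by rewrite big_cons (leq_trans (msizeD_le _ _)) // geq_max HF.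
Qed.

End PolynomialDegree.

(** Degree k+1 in affine functions; [msize] is the degree plus 1. *)
Lemma msize_radau (n : nat) (R : idomainType) (k : nat) (p q : mpoly n R) :
  (mpoly.msize p <= 2)%N -> (mpoly.msize q <= 2)%N ->
  (mpoly.msize (radau k p q) <= k.+2)%N.
Proof.
move=> hp hq; apply: msize_sum_le => i.
have -> : k.+2 = (0 + (k.+1 - i) * 1 + i * 1).+1 by rewrite !muln1 subnK // ltnW.
apply: msizeM_leD (msizeX_leM _ hq).
apply: msizeM_leD (msizeX_leM _ hp).
rewrite -signr_odd mulr_sign; case: ifP => _; rewrite ?msizeN -mpolyC_nat msizeC;
  by case: (_ != 0).
Qed.

Definition mpoly_fun (R : comNzRingType) (n : nat) (p : mpoly n R) (x : 'rV[R]_n) : R :=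
  meval (fun i => x ord0 i) p.

Section Barycentric.
Variables (R : realType) (a : 'I_4 -> 'rV[R]_3).
Hypothesis ha : affinely_independent a.

(** The coordinates come from inverting the matrix of the edges at vertex 0. The
    second property says more than the values at the vertices: it holds for any
    weights of sum 1, also negative ones, hence for points outside the tetrahedron. *)
Lemma barycentric_coordinates : exists lam : 'I_4 -> mpoly 3 R,
  [/\ forall i, (mpoly.msize (lam i) <= 2)%N,
      forall (c : 'I_4 -> R) i, \sum_j c j = 1 ->
        mpoly_fun (lam i) (\sum_j c j *: a j) = c i,
      forall x, \sum_i mpoly_fun (lam i) x = 1
    & forall x, \sum_i mpoly_fun (lam i) x *: a i = x].
Proof.
pose M := \matrix_(i < 3) (a (lift ord0 i) - a ord0).
have uM : M \in unitmx by rewrite -row_free_unit.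
(* The coordinates of x - a 0 in the basis of the edges. *)
pose pos (m : 'I_3) : mpoly 3 R :=
  \sum_j (invmx M j m) *: (mpolyX R (mnm1 j) - mpolyC 3 (a ord0 ord0 j)).
have posE m x : mpoly_fun (pos m) x = ((x - a ord0) *m invmx M) ord0 m.
  rewrite /mpoly_fun /pos raddf_sum /= mxE; apply: eq_bigr => j _.
  by rewrite mevalZ mevalB mevalXU mevalC mulrC !mxE.
have spos m : (mpoly.msize (pos m) <= 2)%N.
  apply: msize_sum_le => j; apply: leq_trans (msizeZ_le _ _) _.
  rewrite (leq_trans (msizeD_le _ _)) // geq_max msizeX mdeg1 msizeN msizeC.
  by case: (_ != 0).
pose lam i := if unlift ord0 i is Some m then pos m else 1 - \sum_m pos m.
have lam0 : lam ord0 = 1 - \sum_m pos m by rewrite /lam unlift_none.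
have lamS m : lam (lift ord0 m) = pos m by rewrite /lam liftK.
have lam0E x : mpoly_fun (lam ord0) x = 1 - \sum_m mpoly_fun (pos m) x.
  by rewrite lam0 /mpoly_fun mevalB meval1 rmorph_sum.
exists lam; split.
- move=> i; have [m ->|->] := unliftP ord0 i; first by rewrite lamS.
  rewrite lam0 (leq_trans (msizeD_le _ _)) // geq_max msize1 msizeN /=.
  exact: msize_sum_le.
- move=> c i sc.
  have cS m : mpoly_fun (pos m) (\sum_j c j *: a j) = c (lift ord0 m).
    rewrite posE.
    have -> : \sum_j c j *: a j - a ord0 = (\row_m c (lift ord0 m)) *m M.
      rewrite -[a ord0 in LHS]scale1r -sc scaler_suml -sumrB.
      rewrite big_ord_recl subrr add0r.
      apply/rowP => l; rewrite summxE !mxE; apply: eq_bigr => m' _.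
      by rewrite !mxE mulrBr.
    by rewrite mulmxK // mxE.
  have [m ->|->] := unliftP ord0 i; first by rewrite lamS.
  by rewrite lam0E -sc big_ord_recl [X in _ - X](eq_bigr _ (fun m _ => cS m)) addrK.
- move=> x; rewrite big_ord_recl lam0E.
  by under [X in _ + X]eq_bigr do rewrite lamS; rewrite subrK.
- move=> x; rewrite big_ord_recl lam0E.
  rewrite scalerBl scale1r scaler_suml -addrA -[RHS](subrK (a ord0)) addrC.
  congr (_ + _); rewrite addrC -sumrB.
  rewrite -[x - a ord0](mulmxKV uM); apply/rowP => l; rewrite summxE mxE.
  by apply: eq_bigr => m _; rewrite lamS -posE -scalerBr !mxE.
Qed.

End Barycentric.

(** * Integrals over a triangle in space *)

Lemma det_mx22 (R : comPzRingType) (A : 'M[R]_2) :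
  \det A = A 0 0 * A 1 1 - A 0 1 * A 1 0.
Proof.
rewrite (expand_det_row _ ord0) !big_ord_recl big_ord0 /cofactor !det_mx11 !mxE.
have -> : lift ord0 0 = 1 :> 'I_2 by apply: val_inj.
have -> : lift 1 0 = 0 :> 'I_2 by apply: val_inj.
by rewrite expr0 expr1 mul1r mulN1r mulrN addr0.
Qed.

(** If u, v are the rows and G their Gram matrix, then w = G00 v - G01 u satisfies
    |w|^2 = G00 det G; a nonpositive determinant forces w = 0, which contradicts
    independence. *)
Lemma gram_det_gt0 (R : realType) (m : nat) (E : 'M[R]_(2, m)) :
  (forall c d, c *: row 0 E + d *: row 1 E = 0 -> c = 0 /\ d = 0) ->
  0 < \det (E *m E^T).
Proof.
move=> inj; set G := E *m E^T.
have GE i j : G i j = \sum_k E i k * E j k.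
  by rewrite mxE; apply: eq_bigr => k _; rewrite mxE.
have G10 : G 1 0 = G 0 1 by rewrite !GE; apply: eq_bigr => k _; rewrite mulrC.
have detG : \det G = G 0 0 * G 1 1 - G 0 1 * G 0 1.
  by rewrite det_mx22 G10.
rewrite ltNge; apply/negP => G0.
pose w k := G 0 0 * E 1 k - G 0 1 * E 0 k.
have sumw : \sum_k w k ^+ 2 = G 0 0 * \det G.
  rewrite detG.
  transitivity (\sum_k (G 0 0 ^+ 2 * (E 1 k * E 1 k) +
     (- (2 * G 0 0 * G 0 1)) * (E 0 k * E 1 k) + G 0 1 ^+ 2 * (E 0 k * E 0 k))).
    by apply: eq_bigr => k _; rewrite /w; ring.
  by rewrite !big_split /= -!mulr_sumr -!GE; ring.
have G00 : 0 <= G 0 0.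
  by rewrite GE sumr_ge0 // => k _; rewrite -expr2 sqr_ge0.
have w0 : \sum_k w k ^+ 2 = 0.
  apply/eqP; rewrite eq_le sumr_ge0 ?andbT => [|k _]; last exact: sqr_ge0.
  by rewrite sumw mulr_ge0_le0.
have wk k : w k = 0.
  apply/eqP; rewrite -sqrf_eq0; apply/eqP.
  by apply: (psumr_eq0P _ w0) => // i _; exact: sqr_ge0.
have [_ G000] : - G 0 1 = 0 /\ G 0 0 = 0.
  apply: inj; apply/rowP => k; have := wk k; rewrite /w.
  by move: (G 0 1) (G 0 0) => g01 g00 E0; rewrite !mxE -E0; ring.
have Ek k : E 0 k = 0.
  apply/eqP; rewrite -sqrf_eq0 expr2; apply/eqP.
  move: G000; rewrite GE => /psumr_eq0P -> // i _.
  by rewrite -expr2 sqr_ge0.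
have [] := inj 1 0; last by move/eqP; rewrite oner_eq0.
by apply/rowP => k; rewrite !mxE Ek mulr0 mul0r addr0.
Qed.

Section PolySpace.
Variable R : realType.
Implicit Types (S : set 'rV[R]_3) (f g : 'rV[R]_3 -> R).

Lemma poly_spaceP m S f : poly_space m S f <->
  exists p : mpoly 3 R, [/\ (mpoly.msize p <= m.+1)%N,
    forall x, S x -> f x = mpoly_fun p x & forall x, ~ S x -> f x = 0].
Proof.
split=> [[p hp ->]|[p [hp fS fC]]]; exists p => //.
  split=> // x Sx; first by rewrite patchE mem_set.
  by rewrite patchE memNset.
apply/funext => x; rewrite patchE; case: ifPn => [/set_mem /fS //|].
by rewrite notin_setE => /fC.
Qed.

Lemma poly_space0 m S : poly_space m S (fun=> 0).
Proof.
apply/poly_spaceP; exists 0; rewrite msize0; split => // x _.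
by rewrite /mpoly_fun meval0.
Qed.

Lemma poly_space_linear m S (c : R) f g : poly_space m S f -> poly_space m S g ->
  poly_space m S (fun x => c * f x + g x).
Proof.
move=> /poly_spaceP[p [hp fp f0]] /poly_spaceP[q [hq gq g0]].
apply/poly_spaceP; exists (c *: p + q); split.
- rewrite (leq_trans (msizeD_le _ _)) // geq_max hq andbT.
  exact: leq_trans (msizeZ_le _ _) hp.
- by move=> x Sx; rewrite /mpoly_fun mevalD mevalZ fp // gq.
- by move=> x Sx; rewrite f0 // g0 // mulr0 addr0.
Qed.

Lemma poly_space_patch m S (p : mpoly 3 R) : (mpoly.msize p <= m.+1)%N ->
  poly_space m S (patch (fun=> 0) S (mpoly_fun p)).
Proof. by move=> hp; exists p. Qed.

End PolySpace.

Section TriangleParametrization.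
Variables (R : realType) (b : 'I_3 -> 'rV[R]_3).

Definition triangle_param (s : R * R) : 'rV[R]_3 :=
  \sum_j triangle_coord j s *: b j.

Lemma simplex_triangle_param s : reference_triangle s -> simplex b (triangle_param s).
Proof.
move=> /reference_triangleP s0; exists (fun j => triangle_coord j s).
by split=> //; exact: sum_triangle_coord.
Qed.

Lemma simplex_triangle_paramP x : simplex b x ->
  exists2 s, reference_triangle s & x = triangle_param s.
Proof.
move=> [c [c0 c1 ->]]; exists (c (lift ord0 ord0), c (lift ord0 (lift ord0 ord0))).
  split=> //=; rewrite -c1 !big_ord_recl big_ord0 addr0.
  by rewrite -[X in X <= _]add0r lerD.
rewrite /triangle_param; apply: eq_bigr => j _; congr (_ *: _).
move: c1; rewrite !big_ord_recl big_ord0 addr0 => c1.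
case: (unliftP ord0 j) => [{}j|] ->; last by rewrite /triangle_coord /= -c1; ring.
case: (unliftP ord0 j) => [{}j|] -> //.
by rewrite [j]ord1.
Qed.

Definition triangle_edges : 'M[R]_(2, 3) :=
  \matrix_(i < 2) (b (lift ord0 i) - b ord0).

Lemma triangle_integralE f : triangle_integral b f =
  Num.sqrt (\det (triangle_edges *m triangle_edges^T)) *
  reference_integral (fun s => f (triangle_param s)).
Proof.
rewrite /triangle_integral -/triangle_edges; congr (_ * _).
apply: eq_Rintegral => s _; congr (f _).
rewrite /triangle_param !big_ord_recl big_ord0 /triangle_coord /= addr0.
rewrite !rowK.
rewrite !scalerBl scale1r !scalerBr.
rewrite (_ : lift ord0 1 = lift ord0 (lift ord0 ord0) :> 'I_3); last exact: val_inj.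
apply/rowP => j; rewrite !mxE; ring.
Qed.

(** Each coordinate of space is affine on the triangle, so each monomial of degree
    e becomes a form of degree e, which is then homogenized to degree d. *)
Lemma triangle_form_poly d (p : mpoly 3 R) : (mpoly.msize p <= d.+1)%N ->
  triangle_form d (fun s => mpoly_fun p (triangle_param s)).
Proof.
have formX e f j k : triangle_form e f ->
    triangle_form (k + e) (fun s => triangle_param s ord0 j ^+ k * f s).
  move=> Hf; elim: k => [|k IH]; first by under eq_fun do rewrite mul1r.
  rewrite (_ : (fun _ => _) = fun s => (\sum_i triangle_coord i s * b i ord0 j) *
    (triangle_param s ord0 j ^+ k * f s)); first exact: triangle_form_affineM.
  apply/funext => s; rewrite exprS -mulrA; congr (_ * _).
  by rewrite /triangle_param summxE; apply: eq_bigr => i _; rewrite mxE.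
have formP (m : 'I_3 -> nat) (r : seq 'I_3) : triangle_form (\sum_(j <- r) m j)
    (fun s => \prod_(j <- r) triangle_param s ord0 j ^+ m j).
  elim: r => [|j r IH].
    by rewrite big_nil; exists 1; apply/funext => s; rewrite big_nil.
  rewrite big_cons; under [X in triangle_form _ X]eq_fun do rewrite big_cons.
  exact: formX.
have formW e f : triangle_form e f -> (e <= d)%N -> triangle_form d f.
  move=> Hf /subnK <-; elim: (d - e)%N => [//|n IH].
  by rewrite addSn; exact: triangle_formS.
move=> /mpolywE -> ; under eq_fun do rewrite /mpoly_fun rmorph_sum.
rewrite (_ : (fun _ => _) = fun s => \sum_(m : bmultinom 3 d.+1)
    mcoeff m p * \prod_(j <- index_enum 'I_3) triangle_param s ord0 j ^+ m j); last first.
  by apply/funext => s; apply: eq_bigr => m _; rewrite /= mevalZ mevalX.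
elim: (index_enum _) => [|m r IH].
  under eq_fun do rewrite big_nil.
  by apply: formW (leq0n d); exists 0.
under eq_fun do rewrite big_cons.
apply: triangle_formD => //; apply: triangle_formZ.
by apply: formW (formP _ _) _; rewrite -mdegE -ltnS bmdeg.
Qed.

End TriangleParametrization.

Section TriangleIntegral.
Variables (R : realType) (b : 'I_3 -> 'rV[R]_3).

Definition triangle_bounded (f : 'rV[R]_3 -> R) : Prop :=
  bounded_measurable (T := plane R) (@reference_triangle R)
    (fun s => f (triangle_param b s)).

Lemma triangle_bounded_linear c f g : triangle_bounded f -> triangle_bounded g ->
  triangle_bounded (fun x => c * f x + g x).
Proof.
move=> bf bg; apply: bounded_measurableD bg; apply: bounded_measurableM bf.
exact: bounded_measurable_cst.
Qed.

Lemma triangle_boundedM f g : triangle_bounded f -> triangle_bounded g ->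
  triangle_bounded (fun x => f x * g x).
Proof. exact: bounded_measurableM. Qed.

Lemma triangle_integral_linear c f g : triangle_bounded f -> triangle_bounded g ->
  triangle_integral b (fun x => c * f x + g x) =
  c * triangle_integral b f + triangle_integral b g.
Proof.
by move=> bf bg; rewrite !triangle_integralE reference_integral_linear // mulrDr mulrCA.
Qed.

Lemma triangle_integral_mull c f g h :
  triangle_bounded f -> triangle_bounded g -> triangle_bounded h ->
  triangle_integral b (fun x => (c * f x + g x) * h x) =
  c * triangle_integral b (fun x => f x * h x) +
  triangle_integral b (fun x => g x * h x).
Proof.
move=> bf bg bh; under [X in triangle_integral _ X]eq_fun do rewrite mulrDl -mulrA.
by rewrite triangle_integral_linear //; exact: triangle_boundedM.
Qed.

Lemma triangle_integral_sum (I : Type) (r : seq I) (c : I -> R)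
    (f : I -> 'rV[R]_3 -> R) :
  (forall i, triangle_bounded (f i)) ->
  triangle_integral b (fun x => \sum_(i <- r) c i * f i x) =
  \sum_(i <- r) c i * triangle_integral b (f i).
Proof.
move=> bf; apply: (functional_sum _ triangle_bounded_linear triangle_integral_linear) => //.
exact: bounded_measurable_cst.
Qed.

Lemma triangle_integral_sumr (I : Type) (r : seq I) (c : I -> R)
    (f : 'rV[R]_3 -> R) (h : I -> 'rV[R]_3 -> R) :
  triangle_bounded f -> (forall i, triangle_bounded (h i)) ->
  triangle_integral b (fun x => f x * \sum_(i <- r) c i * h i x) =
  \sum_(i <- r) c i * triangle_integral b (fun x => f x * h i x).
Proof.
move=> bf bh; rewrite -triangle_integral_sum => [|i]; last exact: triangle_boundedM.
congr triangle_integral; apply/funext => x; rewrite mulr_sumr.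
by apply: eq_bigr => i _; rewrite mulrCA.
Qed.

Lemma poly_space_triangle_form m S f : simplex b `<=` S -> poly_space m S f ->
  exists2 g, triangle_form m g &
    forall s, reference_triangle s -> f (triangle_param b s) = g s.
Proof.
move=> bS /poly_spaceP[p [hp fp _]].
exists (fun s => mpoly_fun p (triangle_param b s)); first exact: triangle_form_poly.
by move=> s hs; apply/fp/bS/simplex_triangle_param.
Qed.

Lemma poly_space_triangle_bounded m S f : simplex b `<=` S -> poly_space m S f ->
  triangle_bounded f.
Proof.
move=> bS /(poly_space_triangle_form bS)[g /bounded_triangle_form bg fg].
by apply: bounded_measurable_eq bg => s /fg.
Qed.

End TriangleIntegral.

(** * Integrals over the tetrahedron *)

Local Notation space R := (measurableTypeR R * measurableTypeR R * measurableTypeR R)%type.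

Section Volume.
Variable R : realType.

Let mu : {measure set (space R) -> \bar R} :=
  (@lebesgue_measure R \x @lebesgue_measure R \x @lebesgue_measure R)%E.

Lemma measurable_mpoly_fun (p : mpoly 3 R) :
  measurable_fun (T := space R) setT (fun x => mpoly_fun p (coord3 x)).
Proof.
apply: (@meval_closed_ind _ _ _ (fun i x => coord3 x ord0 i)
  (fun f => measurable_fun (T := space R) setT f)).
- exact: measurable_cst.
- move=> f g; exact: measurable_funD.
- move=> f g; exact: measurable_funM.
- move=> i; under eq_fun do rewrite /coord3 mxE.
  case: i => [[|[|[|//]]] i] /=.
  + by apply: measurableT_comp; [exact: measurable_fst|exact: measurable_fst].
  + by apply: measurableT_comp; [exact: measurable_snd|exact: measurable_fst].
  + exact: measurable_snd.
Qed.

Lemma continuous_mpoly_fun (p : mpoly 3 R) :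
  continuous (fun x : R * R * R => mpoly_fun p (coord3 x)).
Proof.
apply: (@meval_closed_ind _ _ _ (fun i x => coord3 x ord0 i)
  (fun f : R * R * R -> R => continuous f)).
- move=> c x; exact: cvg_cst.
- by move=> f g cf cg x; apply: cvgD; [exact: cf|exact: cg].
- by move=> f g cf cg x; apply: cvgM; [exact: cf|exact: cg].
- move=> i; under eq_fun do rewrite /coord3 mxE.
  case: i => [[|[|[|//]]] i] /= x.
  + by apply: (@cvg_comp _ _ _ fst fst _ (nbhs x.1)); exact: cvg_fst.
  + by apply: (@cvg_comp _ _ _ fst snd _ (nbhs x.1)); [exact: cvg_fst|exact: cvg_snd].
  + exact: cvg_snd.
Qed.

Lemma box_measure (A B C : set (measurableTypeR R)) :
  measurable A -> measurable B -> measurable C ->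
  mu (A `*` B `*` C) =
  (lebesgue_measure A * lebesgue_measure B * lebesgue_measure C)%E.
Proof.
move=> mA mB mC; have mAB : measurable (A `*` B) by exact: measurableX.
etransitivity; first exact: product_measure1E mAB mC.
by congr (_ * _)%E; exact: product_measure1E.
Qed.

Variable a : 'I_4 -> 'rV[R]_3.
Hypothesis ha : affinely_independent a.

Let D : set (space R) := @coord3 R @^-1` simplex a.

Lemma simplex_coord_bound x : simplex a x ->
  forall j, `|x ord0 j| <= \sum_i \sum_j `|a i ord0 j|.
Proof.
move=> [c [c0 c1 ->]] j; rewrite summxE (le_trans (ler_norm_sum _ _ _)) //.
apply: ler_sum => i _; rewrite mxE normrM ger0_norm //.
have ci : c i <= 1 by rewrite -c1 (bigD1 i) //= lerDl sumr_ge0.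
rewrite (@le_trans _ _ `|a i ord0 j|) ?ler_piMl //.
by rewrite (bigD1 j) //= lerDl sumr_ge0.
Qed.

Lemma measurable_simplex : measurable D.
Proof.
have [lam [_ lamc lam1 lamx]] := barycentric_coordinates ha.
rewrite (_ : D = [set x | forall i, 0 <= mpoly_fun (lam i) (coord3 x)]).
  by apply: measurable_nonneg => i; exact: measurable_mpoly_fun.
apply/seteqP; split=> x /=.
  by move=> [c [c0 c1 ->]] i; rewrite lamc.
by move=> H; exists (fun i => mpoly_fun (lam i) (coord3 x)).
Qed.

Lemma simplex_fin : (mu D < +oo)%E.
Proof.
set M := \sum_i \sum_j `|a i ord0 j|.
pose I : set (measurableTypeR R) := `[- M, M]%classic.
have mI : measurable I by exact: measurable_itv.
apply: (@le_lt_trans _ _ (mu (I `*` I `*` I))).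
  apply: le_measure; rewrite ?inE.
  - exact: measurable_simplex.
  - by apply: measurableX => //; apply: measurableX.
  - move=> x /simplex_coord_bound H.
    have Hi j : `[- M, M]%classic (coord3 x ord0 j).
      by rewrite /= in_itv /= -ler_norml H.
    split; [split|].
    + by have := Hi ord0; rewrite /coord3 mxE.
    + by have := Hi (lift ord0 ord0); rewrite /coord3 mxE.
    + by have := Hi (lift ord0 (lift ord0 ord0)); rewrite /coord3 mxE.
have fI : (lebesgue_measure I \is a fin_num)%E.
  by rewrite /I lebesgue_measure_itv; case: ifP.
rewrite box_measure //.
by rewrite -ge0_fin_numE ?fin_numM // mule_ge0 // mule_ge0.
Qed.

Lemma bounded_mpoly_fun_simplex (p : mpoly 3 R) :
  bounded_measurable (T := space R) D (fun x => mpoly_fun p (coord3 x)).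
Proof.
apply: (@meval_closed_ind _ _ _ (fun i x => coord3 x ord0 i)
  (fun f => bounded_measurable (T := space R) D f)).
- exact: bounded_measurable_cst.
- exact: bounded_measurableD.
- exact: bounded_measurableM.
- move=> i; split.
    have := @measurable_mpoly_fun (mpolyX R (mnm1 i)).
    rewrite /mpoly_fun; under eq_fun do rewrite mevalXU.
    exact: measurable_funTS.
  by exists (\sum_i \sum_j `|a i ord0 j|) => x /simplex_coord_bound.
Qed.

Lemma bounded_poly_space m f : poly_space m (simplex a) f ->
  bounded_measurable (T := space R) D (fun x => f (coord3 x)).
Proof.
move=> /poly_spaceP[p [_ fp _]].
apply: bounded_measurable_eq (bounded_mpoly_fun_simplex p) => x Dx.
by rewrite fp.
Qed.

Lemma volume_integral_linear m f g h c : poly_space m (simplex a) f ->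
  poly_space m (simplex a) g -> poly_space m (simplex a) h ->
  volume_integral (simplex a) (fun x => (c * f x + g x) * h x) =
  c * volume_integral (simplex a) (fun x => f x * h x) +
  volume_integral (simplex a) (fun x => g x * h x).
Proof.
move=> /bounded_poly_space bf /bounded_poly_space bg /bounded_poly_space bh.
rewrite /volume_integral -/D.
rewrite -(Rintegral_linear (mu := mu) measurable_simplex simplex_fin).
- by apply: eq_Rintegral => x _; rewrite mulrDl mulrA.
- exact: bounded_measurableM.
- exact: bounded_measurableM.
Qed.

Lemma volume_integral_sumr m n f (c : 'I_n -> R) (h : 'I_n -> 'rV[R]_3 -> R) :
  poly_space m (simplex a) f -> (forall j, poly_space m (simplex a) (h j)) ->
  volume_integral (simplex a) (fun x => f x * \sum_j c j * h j x) =
  \sum_j c j * volume_integral (simplex a) (fun x => f x * h j x).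
Proof.
move=> Pf Ph.
apply: (functional_sum (poly_space0 m (simplex a))
  (@poly_space_linear _ m (simplex a))
  (I := fun g => volume_integral (simplex a) (fun x => f x * g x))) => //.
move=> e g g' Pg Pg'.
have vC g1 : volume_integral (simplex a) (fun x => f x * g1 x) =
    volume_integral (simplex a) (fun x => g1 x * f x).
  by congr volume_integral; apply/funext => x; rewrite mulrC.
by rewrite !vC (volume_integral_linear _ Pg Pg' Pf).
Qed.

(** Moving from x towards the barycentre makes all coordinates positive at once,
    and p stays nonzero for a short while by continuity. *)
Lemma mpoly_nonzero_interior (lam : 'I_4 -> mpoly 3 R) (p : mpoly 3 R) x :
  (forall (c : 'I_4 -> R) i, \sum_j c j = 1 ->
     mpoly_fun (lam i) (\sum_j c j *: a j) = c i) ->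
  simplex a x -> mpoly_fun p x != 0 ->
  exists2 y, mpoly_fun p y != 0 & forall i, 0 < mpoly_fun (lam i) y.
Proof.
move=> lamc [c [c0 c1 xE]] px.
(* Weights of the point at fraction t of the way to the barycentre. *)
pose w t i := (1 - t) * c i + t / 4%:R.
have w1 t : \sum_i w t i = 1.
  by rewrite big_split /= -mulr_sumr c1 sumr_const card_ord; field.
pose y t := \sum_i w t i *: a i.
have y0 : y 0 = x.
  rewrite xE; apply: eq_bigr => i _.
  by rewrite /w subr0 mul1r mul0r addr0.
have cy : continuous (fun t : R => mpoly_fun p (y t)).
  apply: (@meval_closed_ind _ _ _ (fun i t => y t ord0 i)
    (fun f : R -> R => continuous f)).
  - move=> k t; exact: cvg_cst.
  - by move=> f g cf cg t; apply: cvgD; [exact: cf|exact: cg].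
  - by move=> f g cf cg t; apply: cvgM; [exact: cf|exact: cg].
  - move=> j; pose q : {poly R} := \sum_i
      ((1 - 'X) * (c i)%:P + 'X * (4%:R^-1)%:P) * (a i ord0 j)%:P.
    rewrite (_ : (fun _ => _) = horner q); first exact: continuous_horner.
    apply/funext => t; rewrite /y summxE horner_sum; apply: eq_bigr => i _.
    by rewrite mxE !hornerE.
have : \forall t \near 0^'+, mpoly_fun p (y t) != 0.
  have := cvg_at_right_filter (cy 0); rewrite y0 => H.
  by apply: (cvgr_neq0 _ H).
have t1 : \forall t \near (0:R)^'+, t < 1 by exact: nbhs_right_lt.
have t0 : \forall t \near (0:R)^'+, 0 < t by exact: nbhs_right_gt.
move=> /(filterI t1)/(filterI t0)/filter_ex[t [{}t0 [{}t1 pt]]].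
exists (y t) => // i; rewrite lamc // ltr_wpDl ?divr_gt0 //.
by rewrite mulr_ge0 // subr_ge0 ltW.
Qed.

(** If f is nonzero at some point of the tetrahedron, it is nonzero on a box
    contained in the interior, which has positive measure; but f vanishes almost
    everywhere. *)
Lemma volume_integral_sqr_eq0 m f : poly_space m (simplex a) f ->
  volume_integral (simplex a) (fun x => f x * f x) = 0 -> f = fun=> 0.
Proof.
move=> Pf; have /poly_spaceP[p [_ fp f0]] := Pf.
have [lam [_ lamc lam1 lamx]] := barycentric_coordinates ha.
have bf := bounded_poly_space Pf.
pose g (x : space R) : R := f (coord3 x) * f (coord3 x).
have bg : bounded_measurable D g by exact: bounded_measurableM.
have ig := bounded_measurable_integrable measurable_simplex simplex_fin bg.
rewrite /volume_integral -/D -[fun x => _]/g => I0.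
have {}I0 : (\int[mu]_(x in D) `|(EFin \o g) x| = 0)%E.
  have /fineK := integrable_fin_num measurable_simplex ig.
  rewrite [X in X%:E]I0 => E; rewrite [RHS]E.
  by apply: eq_integral => x _; rewrite /= ger0_norm // /g -expr2 sqr_ge0.
have {I0} := (ae_eq_integral_abs mu measurable_simplex (measurable_int _ ig)).1 I0.
move=> [N [mN N0 DN]].
apply/funext => x; have [Sx|/f0 //] := pselect (simplex a x).
rewrite fp //; apply/eqP; apply: contraT => /(mpoly_nonzero_interior lamc Sx)[y py ly].
pose z : R * R * R :=
  (y ord0 ord0, y ord0 (lift ord0 ord0), y ord0 (lift ord0 (lift ord0 ord0))).
have zy : coord3 z = y.
  apply/rowP => -[[|[|[|//]]] i]; rewrite mxE /=; congr (y _ _); exact: val_inj.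
have pos (q : mpoly 3 R) : 0 < mpoly_fun q (coord3 z) ->
    \forall u \near z, 0 < mpoly_fun q (coord3 u).
  move=> q0; have := cvgr_gt _ (@continuous_mpoly_fun q z) 0 q0. apply.
have near_p : \forall u \near z, mpoly_fun p (coord3 u) != 0.
  by have := cvgr_neq0 _ (@continuous_mpoly_fun p z); rewrite zy; apply.
have near_lam : \forall u \near z, forall i, 0 < mpoly_fun (lam i) (coord3 u).
  have := @filter_forall _ _ (fun i (u : R * R * R) =>
    0 < mpoly_fun (lam i) (coord3 u) : Prop) (nbhs z) _.
  by apply => i; apply: pos; rewrite zy.
have nz : nbhs z [set u : R * R * R | mpoly_fun p (coord3 u) != 0 /\
    forall i, 0 < mpoly_fun (lam i) (coord3 u)] by exact: filterI near_p near_lam.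
have [e /= e0 He] := (@nbhs_ballP R (R * R * R)%type _ _).1 nz.
pose B := ball z.1.1 e `*` ball z.1.2 e `*` ball z.2 e.
have mb r : @measurable _ (measurableTypeR R) (ball r e) by exact: measurable_ball.
have BN : B `<=` N.
  move=> u [[u1 u2] u3]; have [/= pu lu] := He u (conj (conj u1 u2) u3).
  apply: DN => /= H; move: pu.
  have Du : simplex a (coord3 u).
    by exists (fun i => mpoly_fun (lam i) (coord3 u)); split => // i; exact: ltW.
  have := H Du; rewrite /= => -[]/eqP; rewrite mulf_eq0 orbb fp // => ->.
  by [].
have mB : @measurable _ (space R) B.
  by apply: measurableX => //; apply: measurableX.
have := box_measure (mb z.1.1) (mb z.1.2) (mb z.2).
rewrite [LHS](subset_measure0 mB mN BN N0) !lebesgue_measure_ball ?ltW //.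
rewrite -!EFinM => -[] /esym/eqP.
by rewrite !mulf_eq0 !mulrn_eq0 /= gt_eqF.
Qed.

End Volume.

(** * Polynomials with moments on a single face *)

Section Tetrahedron.
Variables (R : realType) (a : 'I_4 -> 'rV[R]_3).
Hypothesis ha : affinely_independent a.

(** The barycentric coordinates, in the tetrahedron, of the point with
    coordinates c in face i. *)
Definition face_weights (i : 'I_4) (c : 'I_3 -> R) (m : 'I_4) : R :=
  if unlift i m is Some j then c j else 0.

Lemma sum_face_weights i c : \sum_m face_weights i c m = \sum_j c j.
Proof.
rewrite (bigD1_ord i) //= /face_weights unlift_none add0r.
by apply: eq_bigr => j _; rewrite liftK.
Qed.

Lemma face_weightsE i c : \sum_j c j *: face a i j = \sum_m face_weights i c m *: a m.
Proof.
rewrite [RHS](bigD1_ord i) //= /face_weights unlift_none scale0r add0r.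
by apply: eq_bigr => j _; rewrite liftK.
Qed.

Lemma face_sub_simplex i : simplex (face a i) `<=` simplex a.
Proof.
move=> x [c [c0 c1 ->]]; exists (face_weights i c); split.
- by move=> m; rewrite /face_weights; case: unliftP.
- by rewrite sum_face_weights.
- exact: face_weightsE.
Qed.

Lemma barycentric_face : exists lam : 'I_4 -> mpoly 3 R,
  (forall i, (mpoly.msize (lam i) <= 2)%N) /\
  (forall i m s, mpoly_fun (lam m) (triangle_param (face a i) s) =
     face_weights i (fun j => triangle_coord j s) m).
Proof.
have [lam [hlam lamc _ _]] := barycentric_coordinates ha; exists lam; split => //.
move=> i m s; rewrite /triangle_param face_weightsE lamc //.
by rewrite sum_face_weights sum_triangle_coord.
Qed.

(** The parametrization of a face is injective because the barycentric coordinates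
    of the tetrahedron recover its parameters, so the two edge vectors are
    independent. *)
Lemma face_area_neq0 i :
  Num.sqrt (\det (triangle_edges (face a i) *m (triangle_edges (face a i))^T)) != 0.
Proof.
rewrite gt_eqF // sqrtr_gt0; apply: gram_det_gt0 => c d H.
have [lam [_ lamF]] := barycentric_face.
have E : triangle_param (face a i) (c, d) = triangle_param (face a i) (0, 0).
  apply/eqP; rewrite -subr_eq0; apply/eqP; rewrite -H !rowK.
  rewrite (_ : lift ord0 1 = lift ord0 (lift ord0 ord0) :> 'I_3); last exact: val_inj.
  rewrite /triangle_param !big_ord_recl !big_ord0 /triangle_coord /=.
  by apply/rowP => j; rewrite !mxE; ring.
split.
- have := lamF i (lift i (lift ord0 ord0)) (c, d).
  by rewrite E lamF /face_weights liftK /triangle_coord.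
- have := lamF i (lift i (lift ord0 (lift ord0 ord0))) (c, d).
  by rewrite E lamF /face_weights liftK /triangle_coord.
Qed.

Lemma face_integral_eq0 i f : triangle_integral (face a i) f = 0 ->
  reference_integral (fun s => f (triangle_param (face a i) s)) = 0.
Proof.
rewrite triangle_integralE => /eqP.
by rewrite mulf_eq0 (negPf (face_area_neq0 i)) => /eqP.
Qed.

Variable k : nat.
Hypothesis hk : k = 2%N \/ k = 3%N.

(** Bubbles are the case where A contains all faces; the polynomials used to
    prescribe the moments on face l are those with A the faces other than l. *)
Definition moment_free (A : pred 'I_4) : set ('rV[R]_3 -> R) :=
  [set v | poly_space k.+1 (simplex a) v /\
    forall i q, A i -> poly_space k.-1 (simplex (face a i)) q ->
      triangle_integral (face a i) (fun x => v x * q x) = 0].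

Lemma bubble_spaceE : bubble_space k a = moment_free predT.
Proof.
by apply/seteqP; split=> v [Pv Hv]; split=> // i q; [move=> _|]; exact: Hv.
Qed.

Lemma moment_free0 A : moment_free A (fun=> 0).
Proof.
split=> [|i q _ _]; first exact: poly_space0.
rewrite triangle_integralE; under [X in reference_integral X]eq_fun do rewrite mul0r.
by rewrite reference_integral0 mulr0.
Qed.

Lemma tetra_face_bounded m v i : poly_space m (simplex a) v ->
  triangle_bounded (face a i) v.
Proof. exact: poly_space_triangle_bounded (@face_sub_simplex i). Qed.

Lemma moment_free_linear A c f g : moment_free A f -> moment_free A g ->
  moment_free A (fun x => c * f x + g x).
Proof.
move=> [Pf Hf] [Pg Hg]; split; first exact: poly_space_linear.
move=> i q Ai Pq; have bq := poly_space_triangle_bounded (@subset_refl _ _) Pq.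
rewrite triangle_integral_mull ?Hf ?Hg ?mulr0 ?addr0 //;
  by apply: tetra_face_bounded; eassumption.
Qed.

(** The Radau polynomial in the coordinates of vertices [lift l j] and l. On the
    face opposite to [lift l j] its first argument is 0; on the two remaining
    faces, other than l, both arguments are coordinates of the triangle. *)
Lemma one_face_edge l j : exists2 v, moment_free (predC1 l) v &
  forall s, reference_triangle s ->
    v (triangle_param (face a l) s) = triangle_coord j s ^+ k.+1.
Proof.
have [lam [hlam lamF]] := barycentric_face.
pose p := radau k (lam (lift l j)) (lam l).
have vE i s : reference_triangle s ->
    patch (fun=> 0) (simplex a) (mpoly_fun p) (triangle_param (face a i) s) =
    radau k (face_weights i (fun j => triangle_coord j s) (lift l j))
      (face_weights i (fun j => triangle_coord j s) l).
  move=> hs; rewrite patchE mem_set; last first.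
    exact/face_sub_simplex/simplex_triangle_param.
  by rewrite /mpoly_fun rmorph_radau /= -!/(mpoly_fun _ _) !lamF.
exists (patch (fun=> 0) (simplex a) (mpoly_fun p)); last first.
  by move=> s hs; rewrite vE // /face_weights liftK unlift_none radau0r.
split; first by apply: poly_space_patch; exact: msize_radau.
move=> i q /= il /poly_space_triangle_form - /(_ _ (@subset_refl _ _))[g Hg qg].
rewrite triangle_integralE (@eq_reference_integral _ _ (fun s =>
  radau k (face_weights i (fun j => triangle_coord j s) (lift l j))
      (face_weights i (fun j => triangle_coord j s) l) * g s)); last first.
  by move=> s hs; rewrite vE // qg.
rewrite /face_weights; case: (unliftP i l) il => [y ->|->]; last by rewrite eqxx.
move=> _; case: (unliftP i (lift (lift i y) j)) => [x xE|iE].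
  rewrite radau_orthogonal ?mulr0 //; apply/eqP => xy.
  by have := neq_lift (lift i y) j; rewrite xE xy eqxx.
under [X in reference_integral X]eq_fun do rewrite radau0l mul0r.
by rewrite reference_integral0 mulr0.
Qed.

(** The product contains the coordinates of all vertices of face l. Any face other
    than l is opposite to one of these vertices. *)
Lemma one_face_bubble l (e : 'I_3 -> nat) : (\sum_j e j = k.-2)%N ->
  exists2 v, moment_free (predC1 l) v & forall s, reference_triangle s ->
    v (triangle_param (face a l) s) = triangle_monomial (fun j => (e j).+1) s.
Proof.
move=> se; have [lam [hlam lamF]] := barycentric_face.
pose p := \prod_j lam (lift l j) ^+ (e j).+1.
have vE i s : reference_triangle s ->
    patch (fun=> 0) (simplex a) (mpoly_fun p) (triangle_param (face a i) s) =
    \prod_j face_weights i (fun j => triangle_coord j s) (lift l j) ^+ (e j).+1.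
  move=> hs; rewrite patchE mem_set; last first.
    exact/face_sub_simplex/simplex_triangle_param.
  rewrite /mpoly_fun rmorph_prod; apply: eq_bigr => j _.
  by rewrite rmorphXn /= -/(mpoly_fun _ _) lamF.
exists (patch (fun=> 0) (simplex a) (mpoly_fun p)); last first.
  by move=> s hs; rewrite vE //; apply: eq_bigr => j _; rewrite /face_weights liftK.
split.
  apply: poly_space_patch.
  have -> : k.+1 = (\sum_j (e j).+1 * 1)%N.
    under eq_bigr do rewrite muln1 -addn1.
    by rewrite big_split /= se sum1_card card_ord; case: hk => ->.
  rewrite /p; elim: (index_enum _) => [|j r IH]; first by rewrite !big_nil msize1.
  by rewrite !big_cons; apply: msizeM_leD => //; exact: msizeX_leM.
move=> i q /= il _.
rewrite triangle_integralE (@eq_reference_integral _ _ (fun=> 0)).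
  by rewrite reference_integral0 mulr0.
move=> s hs; rewrite vE //.
case: (unliftP l i) il => [j ->|->]; last by rewrite eqxx.
by move=> _; rewrite (bigD1 j) //= /face_weights unlift_none expr0n /= !mul0r.
Qed.

Lemma one_face_nondegenerate l q : poly_space k.-1 (simplex (face a l)) q ->
  (forall v, moment_free (predC1 l) v ->
     triangle_integral (face a l) (fun x => v x * q x) = 0) ->
  q = fun=> 0.
Proof.
move=> Pq Hq.
have [g Hg qg] := poly_space_triangle_form (@subset_refl _ _) Pq.
have g0 : forall s, g s = 0.
  apply: (triangle_form_nondegenerate hk Hg).
  - move=> j; have [v Wv vE] := one_face_edge l j.
    rewrite -[RHS](face_integral_eq0 (Hq v Wv)).
    by apply: eq_reference_integral => s hs; rewrite vE // qg.
  - move=> e se; have [v Wv vE] := one_face_bubble l se.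
    rewrite -[RHS](face_integral_eq0 (Hq v Wv)).
    by apply: eq_reference_integral => s hs; rewrite vE // qg.
have /poly_spaceP[p [_ _ q0]] := Pq.
apply/funext => x; have [Fx|/q0 //] := pselect (simplex (face a l) x).
by have [s hs ->] := simplex_triangle_paramP Fx; rewrite qg.
Qed.

End Tetrahedron.

(** * Unisolvence *)

Section Unisolvence.
Variables (R : realType) (a : 'I_4 -> 'rV[R]_3).
Hypothesis ha : affinely_independent a.
Variable k : nat.
Hypothesis hk : k = 2%N \/ k = 3%N.

Lemma face_interpolation l n (phi : 'I_n -> 'rV[R]_3 -> R) (alpha : 'I_n -> R) :
  is_basis (poly_space k.-1 (simplex (face a l))) phi ->
  exists2 v, moment_free a k (predC1 l) v &
    forall j, triangle_integral (face a l) (fun x => v x * phi j x) = alpha j.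
Proof.
move=> Bphi; have [Pphi _] := Bphi.
have bphi j := poly_space_triangle_bounded (@subset_refl _ _) (Pphi j).
have bW v : moment_free a k (predC1 l) v -> triangle_bounded (face a l) v.
  by case=> Pv _; exact: tetra_face_bounded Pv.
apply: (@dual_interpolation _ _ (moment_free a k (predC1 l)) _
  (fun j v => triangle_integral (face a l) (fun x => v x * phi j x))).
- exact: moment_free0.
- exact: moment_free_linear.
- by move=> j c f g /bW bf /bW bg; exact: triangle_integral_mull.
- move=> u Hu; apply: (basis_independent _ Bphi); first exact: poly_space0.
  apply: (one_face_nondegenerate ha hk).
    exact: (closed_sum (poly_space0 _ _) (@poly_space_linear _ _ _)).
  by move=> v Wv; rewrite triangle_integral_sumr ?Hu //; exact: bW.
Qed.

(** A polynomial without face moments is a bubble, hence a combination of the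
    functions psi; being orthogonal to these, it is orthogonal to itself. *)
Lemma dofs_eq0 (nF : 'I_4 -> nat) (phi : forall i, 'I_(nF i) -> 'rV[R]_3 -> R)
    (nB : nat) (psi : 'I_nB -> 'rV[R]_3 -> R) v :
  (forall i, is_basis (poly_space k.-1 (simplex (face a i))) (phi i)) ->
  is_basis (bubble_space k a) psi ->
  poly_space k.+1 (simplex a) v ->
  (forall i j, triangle_integral (face a i) (fun x => v x * phi i j x) = 0) ->
  (forall j, volume_integral (simplex a) (fun x => v x * psi j x) = 0) ->
  v = fun=> 0.
Proof.
move=> hphi [Ppsi psiU] Pv Fv Vv.
have Bv : bubble_space k a v.
  split=> // i q Pq; have [Pphi /(_ q Pq)[c [-> _]]] := hphi i.
  rewrite triangle_integral_sumr ?big1 // => [j _||j]; first by rewrite Fv mulr0.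
    exact: tetra_face_bounded Pv.
  exact: poly_space_triangle_bounded (@subset_refl _ _) (Pphi j).
apply: (volume_integral_sqr_eq0 ha Pv); have [c [vE _]] := psiU v Bv.
rewrite (_ : (fun _ => _) = fun x => v x * \sum_j c ord0 j * psi j x); last first.
  by apply/funext => x; rewrite {2}vE.
rewrite (volume_integral_sumr ha _ Pv (fun j => (Ppsi j).1)).
by rewrite big1 // => j _; rewrite Vv mulr0.
Qed.

Lemma bubble_interpolation n (psi : 'I_n -> 'rV[R]_3 -> R) (beta : 'I_n -> R) :
  is_basis (bubble_space k a) psi ->
  exists2 v, bubble_space k a v &
    forall j, volume_integral (simplex a) (fun x => v x * psi j x) = beta j.
Proof.
move=> Bpsi; have [Ppsi _] := Bpsi.
have B0 : bubble_space k a (fun=> 0) by rewrite bubble_spaceE; exact: moment_free0.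
have BL c f g : bubble_space k a f -> bubble_space k a g ->
    bubble_space k a (fun x => c * f x + g x).
  by rewrite bubble_spaceE; exact: moment_free_linear.
apply: (@dual_interpolation _ _ (bubble_space k a) _
  (fun j v => volume_integral (simplex a) (fun x => v x * psi j x))) => //.
- by move=> j c f g [Pf _] [Pg _]; exact: volume_integral_linear Pf Pg (Ppsi j).1.
- move=> u Hu; apply: (basis_independent B0 Bpsi).
  set w := fun x => _; have Bw : bubble_space k a w by exact: closed_sum.
  apply: (volume_integral_sqr_eq0 ha Bw.1).
  by rewrite (volume_integral_sumr ha _ Bw.1 (fun j => (Ppsi j).1)) Hu.
Qed.

End Unisolvence.

Theorem theorem1 (R : realType) (a : 'I_4 -> 'rV[R]_3)
    (ha : affinely_independent a) (k : nat) (hk : k = 2%N \/ k = 3%N)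
    (nF : 'I_4 -> nat) (phi : forall i : 'I_4, 'I_(nF i) -> 'rV[R]_3 -> R)
    (hphi : forall i : 'I_4,
       is_basis (poly_space k.-1 (simplex (face a i))) (phi i))
    (nB : nat) (psi : 'I_nB -> 'rV[R]_3 -> R)
    (hpsi : is_basis (bubble_space k a) psi)
    (alpha : forall i : 'I_4, 'I_(nF i) -> R) (beta : 'I_nB -> R) :
  exists! v : 'rV[R]_3 -> R,
    [/\ poly_space k.+1 (simplex a) v,
        forall (i : 'I_4) (j : 'I_(nF i)),
          triangle_integral (face a i) (fun x => v x * phi i j x) = alpha i j
      & forall j : 'I_nB,
          volume_integral (simplex a) (fun x => v x * psi j x) = beta j].
Proof.
have Pphi i j : poly_space k.-1 (simplex (face a i)) (phi i j) := (hphi i).1 j.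
have bphi i j := poly_space_triangle_bounded (@subset_refl _ _) (Pphi i j).
have Ppsi j : poly_space k.+1 (simplex a) (psi j) := (hpsi.1 j).1.
have bT i v : poly_space k.+1 (simplex a) v -> triangle_bounded (face a i) v.
  exact: tetra_face_bounded.
have /choice[v_ Hv_] : forall l, exists v, moment_free a k (predC1 l) v /\
    forall j, triangle_integral (face a l) (fun x => v x * phi l j x) = alpha l j.
  move=> l; have [v Wv Ev] := face_interpolation ha hk (alpha l) (hphi l).
  by exists v.
(* The face moments are right; those against psi are corrected by w. *)
pose v0 x := \sum_l 1 * v_ l x.
have Pv0 : poly_space k.+1 (simplex a) v0.
  apply: (closed_sum (poly_space0 _ _) (@poly_space_linear _ _ _)) => l.
  exact: (Hv_ l).1.1.
have Ev0 i j : triangle_integral (face a i) (fun x => v0 x * phi i j x) = alpha i j.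
  rewrite (_ : (fun _ => _) = fun x => \sum_l 1 * (v_ l x * phi i j x)); last first.
    by apply/funext => x; rewrite mulr_suml; apply: eq_bigr => l _; rewrite mulrA.
  rewrite triangle_integral_sum => [|l]; last first.
    by apply: triangle_boundedM (bphi i j); exact: bT (Hv_ l).1.1.
  rewrite (bigD1 i) //= (Hv_ i).2 mul1r big1 ?addr0 // => l li.
  by rewrite ((Hv_ l).1.2 i) ?mulr0 //= eq_sym.
have [w [Pw Hw] Ew] := bubble_interpolation ha
  (fun j => beta j - volume_integral (simplex a) (fun x => v0 x * psi j x)) hpsi.
have [v [Pv Fv Vv]] : exists v, [/\ poly_space k.+1 (simplex a) v,
    forall i j, triangle_integral (face a i) (fun x => v x * phi i j x) = alpha i j
  & forall j, volume_integral (simplex a) (fun x => v x * psi j x) = beta j].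
  exists (fun x => 1 * v0 x + w x); split; first exact: poly_space_linear.
    move=> i j; rewrite triangle_integral_mull ?Ev0 ?mul1r ?Hw ?addr0 //.
      exact: bT Pv0.
    exact: bT Pw.
  by move=> j; rewrite (volume_integral_linear ha _ Pv0 Pw (Ppsi j)) Ew mul1r addrC subrK.
exists v; split=> // v' [Pv' Fv' Vv'].
have d0 : (fun x => -1 * v x + v' x) = fun=> 0.
  apply: (dofs_eq0 ha hphi hpsi) => [|i j|j]; first exact: poly_space_linear.
    rewrite triangle_integral_mull ?Fv ?Fv' ?mulN1r ?addNr //.
      exact: bT Pv.
    exact: bT Pv'.
  by rewrite (volume_integral_linear ha _ Pv Pv' (Ppsi j)) Vv Vv' mulN1r addNr.
apply/funext => x; have /eqP := congr1 (fun f => f x) d0.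
by rewrite /= mulN1r addrC subr_eq0 => /eqP.
Qed.
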